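(* If $A_\bullet\to B_\bullet$ is a homotopy action of $\Omega Y$ on $X$, and $L:Top\to Top$ is an HM functor, then $LA_\bullet\to LB_\bullet$ is a homotopy action of $L\Omega Y$ on $LX$.
   Context: Spaces are topological spaces of the homotopy type of CW complexes; $Top$ is their category. A loop space is a space $\Omega Y$ with $Y$ pointed connected. A simplicial space is a functor $\Delta^{op}\to Top$; $LA_\bullet$ is $L$ applied in each level. A functor $L:Top\to Top$ is a homotopy monoidal (HM) functor if it preserves homotopy equivalences, contractible spaces, and finite products up to homotopy, i.e. for all spaces $X,Y$ the canonical map $L(X\times Y)\to LX\times LY$ is a homotopy equivalence. Reduced Segal spaces. A reduced Segal space is a simplicial space $B_\bullet$ with (i) $B_0\simeq *$; (ii) for $n\ge1$ the map $B_n\to (B_1)^n$ induced by $i_k:[1]\to[n]$, $0\mapsto k-1$, $1\mapsto k$ ($1\le k\le n$), is a homotopy equivalence; (iii) the monoid $\pi_0(B_1)$ is a group. For such $B_\bullet$ there is a natural homotopy equivalence $B_1\to\Omega|B_\bullet|$, through which $B_1$ has the homotopy type of a loop space. $B_\bullet$ is a reduced Segal space for $S$, where $S$ is a space of the homotopy type of a loop space, if it is equipped with a loop equivalence $B_1\to S$ (for $S=\Omega Y$ this is equivalent to a homotopy equivalence $|B_\bullet|\to Y$). The space $L\Omega Y$ is regarded as having the homotopy type of a loop space via $LB_1\simeq L\Omega Y$. Homotopy actions. A homotopy action of $S$ (a space of the homotopy type of a loop space) on a space $X$ is a simplicial map $\pi:A_\bullet\to B_\bullet$ such that $A_0\simeq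 X$; $B_\bullet$ is a reduced Segal space for $S$; and for every $n$ both maps $(d_1\cdots d_n)\times\pi_n$ and $(d_0\cdots d_0)\times\pi_n:A_n\to A_0\times B_n$ are homotopy equivalences. *)

(* Defs.v *)
From HB Require Import structures.
From Stdlib Require Import Relation_Operators Operators_Properties.
From mathcomp Require Import all_boot all_order all_algebra generic_quotient.
From mathcomp Require Import all_classical all_reals all_analysis homotopy.

Set Implicit Arguments.
Unset Strict Implicit.
Unset Printing Implicit Defensive.

Import Order.TTheory GRing.Theory Num.Theory.
Import numFieldNormedType.Exports.

Local Open Scope classical_set_scope.
Local Open Scope ring_scope.
Local Open Scope quotient_scope.

Section interval.
Variable R : realType.

Definition unit_itv : Type := (`[0, 1]%classic : set R).

HB.instance Definition _ := Topological.copy unit_itv (`[0, 1]%classic : set R).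

Lemma interval0_subproof : (0 : R) \in (`[0, 1]%classic : set R).
Proof. by rewrite inE /= in_itv /= lexx ler01. Qed.

Lemma interval1_subproof : (1 : R) \in (`[0, 1]%classic : set R).
Proof. by rewrite inE /= in_itv /= lexx ler01. Qed.

Definition interval0 : unit_itv := exist _ 0 interval0_subproof.
Definition interval1 : unit_itv := exist _ 1 interval1_subproof.

Lemma interval01_neq : interval0 != interval1.
Proof.
apply/eqP => /(congr1 (fun s : unit_itv => set_val s : R)) /esym/eqP.
by rewrite set_valE /= oner_eq0.
Qed.

HB.instance Definition _ := isBiPointed.Build unit_itv interval01_neq.

End interval.

Section homotopy.
Variable R : realType.
Implicit Types X Y : topologicalType.

Definition homotopic X Y (f g : X -> Y) : Prop :=
  exists2 H : X * unit_itv R -> Y, continuous H &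
    forall x, H (x, zero) = f x /\ H (x, one) = g x.

Definition homotopy_inverse X Y (f : X -> Y) (g : Y -> X) : Prop :=
  [/\ continuous g, homotopic (g \o f) idfun & homotopic (f \o g) idfun].

Definition homotopy_equivalence X Y (f : X -> Y) : Prop :=
  continuous f /\ exists g : Y -> X, homotopy_inverse f g.

Definition homotopy_equivalent X Y : Prop :=
  exists f : X -> Y, homotopy_equivalence f.

Definition contractible X : Prop :=
  exists x : X, homotopic (cst x) (@idfun X).

End homotopy.

Section cw_complexes.
Variable R : realType.

Definition sqnorm n (v : 'rV[R]_n) : R := \sum_i v ord0 i ^+ 2.

Definition disc n : set 'rV[R]_n := [set v | sqnorm v <= 1].
Definition open_disc n : set 'rV[R]_n := [set v | sqnorm v < 1].
Definition sphere n : set 'rV[R]_n := [set v | sqnorm v = 1].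

Arguments disc n _ : clear implicits.
Arguments open_disc n _ : clear implicits.
Arguments sphere n _ : clear implicits.

(* J. H. C. Whitehead's definition: a Hausdorff space which is, as a set, the
   disjoint union of the images of the open discs under characteristic maps,
   closure-finite, and with the weak topology. *)
Definition is_cw_complex (K : topologicalType) : Prop :=
  hausdorff_space K /\
  exists (cell : nat -> Type) (char : forall n, cell n -> 'rV[R]_n -> K),
  [/\ forall n e, {within disc n, continuous (char n e)},
      forall x, exists! p : {n & (cell n * 'rV[R]_n)%type},
        open_disc _ (projT2 p).2 /\ char (projT1 p) (projT2 p).1 (projT2 p).2 = x,
      forall n e, exists2 F : set {m & cell m}, finite_set F &
        (forall c, F c -> (projT1 c < n)%N) /\
        (forall v, sphere n v -> exists2 c, F c &
           exists2 w, open_disc _ w & char (projT1 c) (projT2 c) w = char n e v) &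
      forall A : set K, closed A <->
        forall n e, closed (disc n `&` char n e @^-1` A)].

Definition cw_type (X : topologicalType) : Prop :=
  exists2 K : topologicalType, is_cw_complex K & homotopy_equivalent R X K.

Record cw_space := CWSpace {
  cw_space_carrier :> topologicalType;
  cw_space_type : cw_type cw_space_carrier }.

End cw_complexes.

Section hm_functors.
Variable R : realType.

Record top_functor := TopFunctor {
  top_obj :> cw_space R -> cw_space R;
  top_map : forall X Y : cw_space R,
    continuousType X Y -> continuousType (top_obj X) (top_obj Y);
  top_map_id : forall X : cw_space R, top_map (idfun : continuousType X X) =1 idfun;
  top_map_comp : forall (X Y Z : cw_space R)
    (f : continuousType X Y) (g : continuousType Y Z),
    top_map (g \o f : continuousType X Z) =1 top_map g \o top_map f }.

Lemma fst_continuous (X Y : topologicalType) : continuous (@fst X Y).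
Proof. by move=> p; exact: cvg_fst. Qed.

Lemma snd_continuous (X Y : topologicalType) : continuous (@snd X Y).
Proof. by move=> p; exact: cvg_snd. Qed.

Definition fst_map (X Y : topologicalType) : continuousType (X * Y)%type X :=
  mkcts (@fst_continuous X Y).
Definition snd_map (X Y : topologicalType) : continuousType (X * Y)%type Y :=
  mkcts (@snd_continuous X Y).

Definition canonical_map (L : top_functor) (X Y : cw_space R)
    (XY : cw_type R (X * Y)%type) : L (CWSpace XY) -> L X * L Y :=
  fun z => (top_map L (fst_map X Y : continuousType (CWSpace XY) X) z,
            top_map L (snd_map X Y : continuousType (CWSpace XY) Y) z).

(* The hypothesis [cw_type R (X * Y)] always holds (Milnor, 1959); it is there
   only to make the product an object of the category. *)
Record hm_functor (L : top_functor) : Prop := HMFunctor {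
  hm_equivalence : forall (X Y : cw_space R) (f : continuousType X Y),
    homotopy_equivalence R f -> homotopy_equivalence R (top_map L f);
  hm_contractible : forall X : cw_space R, contractible R X -> contractible R (L X);
  hm_product : forall (X Y : cw_space R) (XY : cw_type R (X * Y)%type),
    homotopy_equivalence R (@canonical_map L X Y XY) }.

End hm_functors.

Section simplicial_spaces.
Variable R : realType.

Definition coface n (i : 'I_n.+2) : 'I_n.+1 -> 'I_n.+2 := lift i.

Lemma coface_le n (i : 'I_n.+2) : {homo coface i : j k / (j <= k)%O}.
Proof.
move=> j k; rewrite !leEord /coface /= => jk.
by rewrite leq_bump2.
Qed.

HB.instance Definition _ n (i : 'I_n.+2) :=
  Order.isOrderMorphism.Build _ 'I_n.+1 _ 'I_n.+2 (coface i) (@coface_le n i).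

(* The map [1] -> [n], 0 |-> k, 1 |-> k + 1, for 0 <= k < n. *)
Definition spine n (k : 'I_n) (j : 'I_2) : 'I_n.+1 := inord (k + j).

Lemma spine_le n (k : 'I_n) : {homo spine k : i j / (i <= j)%O}.
Proof.
have bound (j : 'I_2) : (k + j < n.+1)%N.
  have j1 : (j <= 1)%N by rewrite -ltnS.
  by rewrite ltnS (leq_trans (leq_add (leqnn k) j1)) // addn1.
by move=> i j; rewrite !leEord /spine !inordK // leq_add2l.
Qed.

HB.instance Definition _ n (k : 'I_n) :=
  Order.isOrderMorphism.Build _ 'I_2 _ 'I_n.+1 (spine k) (@spine_le n k).

Record simplicial_space := SimplicialSpace {
  level :> nat -> cw_space R;
  act : forall m n, {omorphism 'I_m.+1 -> 'I_n.+1} ->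
    continuousType (level n) (level m);
  act_id : forall n, act (idfun : {omorphism 'I_n.+1 -> 'I_n.+1}) =1 idfun;
  act_comp : forall m n p (f : {omorphism 'I_m.+1 -> 'I_n.+1})
    (g : {omorphism 'I_n.+1 -> 'I_p.+1}),
    act (g \o f : {omorphism 'I_m.+1 -> 'I_p.+1}) =1 act f \o act g }.

Record simplicial_map (A B : simplicial_space) := SimplicialMap {
  smap :> forall n, continuousType (A n) (B n);
  smap_act : forall m n (f : {omorphism 'I_m.+1 -> 'I_n.+1}),
    smap m \o act A f =1 act B f \o smap n }.

Definition face (A : simplicial_space) n (i : 'I_n.+2) :
  continuousType (A n.+1) (A n) := act A (coface i).

Lemma apply_act_id (L : top_functor R) (A : simplicial_space) n :
  top_map L (act A (idfun : {omorphism 'I_n.+1 -> 'I_n.+1})) =1 idfun.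
Proof.
move=> x; rewrite -[RHS](@top_map_id _ L (A n)); congr (top_map L _ x).
by apply/continuousEP; exact: act_id.
Qed.

Lemma apply_act_comp (L : top_functor R) (A : simplicial_space) m n p
    (f : {omorphism 'I_m.+1 -> 'I_n.+1}) (g : {omorphism 'I_n.+1 -> 'I_p.+1}) :
  top_map L (act A (g \o f : {omorphism 'I_m.+1 -> 'I_p.+1})) =1
  top_map L (act A f) \o top_map L (act A g).
Proof.
move=> x; rewrite -top_map_comp; congr (top_map L _ x).
by apply/continuousEP; exact: act_comp.
Qed.

Definition apply_simplicial (L : top_functor R) (A : simplicial_space) :=
  SimplicialSpace (@apply_act_id L A) (@apply_act_comp L A).

Lemma apply_smap_act (L : top_functor R) (A B : simplicial_space)
    (q : simplicial_map A B) m n (f : {omorphism 'I_m.+1 -> 'I_n.+1}) :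
  top_map L (q m) \o act (apply_simplicial L A) f =1
  act (apply_simplicial L B) f \o top_map L (q n).
Proof.
move=> x; rewrite /= -[LHS](top_map_comp (act A f) (q m) x).
rewrite -[RHS](top_map_comp (q n) (act B f) x).
by congr (top_map L _ x); apply/continuousEP; exact: smap_act.
Qed.

Definition apply_simplicial_map (L : top_functor R) (A B : simplicial_space)
    (q : simplicial_map A B) :
    simplicial_map (apply_simplicial L A) (apply_simplicial L B) :=
  @SimplicialMap (apply_simplicial L A) (apply_simplicial L B)
    (fun n => top_map L (q n)) (@apply_smap_act L A B q).

End simplicial_spaces.

Section generated_equivalence.
Variables (T : choiceType) (r : T -> T -> Prop).

Definition gen_equiv : rel T := fun x y => `[< clos_refl_sym_trans T r x y >].

Lemma gen_equiv_refl : reflexive gen_equiv.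
Proof. by move=> x; apply/asboolP; exact: rst_refl. Qed.

Lemma gen_equiv_sym : symmetric gen_equiv.
Proof.
by move=> x y; apply/asboolP/asboolP => xy; exact: rst_sym.
Qed.

Lemma gen_equiv_trans : transitive gen_equiv.
Proof.
by move=> y x z /asboolP xy /asboolP yz; apply/asboolP; exact: rst_trans xy yz.
Qed.

Canonical gen_equiv_equiv :=
  EquivRel gen_equiv gen_equiv_refl gen_equiv_sym gen_equiv_trans.

End generated_equivalence.

Section reduced_segal_spaces.
Variable R : realType.

Definition path_related (X : topologicalType) (x y : X) : Prop :=
  inhabited {path unit_itv R from x to y}.

Definition pi0 (X : topologicalType) := {eq_quot (gen_equiv (@path_related X))}.

Definition pi0_class (X : topologicalType) (x : X) : pi0 X := \pi_(pi0 X) x.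

Definition segal_map (B : simplicial_space R) n :
    B n -> {ptws 'I_n -> B 1%N} :=
  fun b k => act B (spine k) b.

(* By the Segal condition for n = 2, the last clause determines mul. *)
Definition pi0_is_group (B : simplicial_space R) : Prop :=
  exists (mul : pi0 (B 1%N) -> pi0 (B 1%N) -> pi0 (B 1%N)) (e : pi0 (B 1%N))
         (inv : pi0 (B 1%N) -> pi0 (B 1%N)),
  [/\ associative mul, left_id e mul, left_inverse e inv mul &
      forall b : B 2%N,
        mul (pi0_class (segal_map b ord0)) (pi0_class (segal_map b ord_max)) =
        pi0_class (face B (inord 1) b)].

Record reduced_segal (B : simplicial_space R) : Prop := ReducedSegal {
  segal_contractible : contractible R (B 0%N);
  segal_equivalence : forall n, (1 <= n)%N ->
    homotopy_equivalence R (@segal_map B n);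
  segal_group : pi0_is_group B }.

End reduced_segal_spaces.

Section realization.
Variable R : realType.

Definition simplex n : set 'rV[R]_n.+1 :=
  [set t | (forall i, 0 <= t ord0 i) /\ \sum_i t ord0 i = 1].

Arguments simplex n _ : clear implicits.

Definition simplex_point n (t : 'rV[R]_n.+1) (ht : t \in simplex n) : simplex n :=
  exist _ t ht.

Lemma push_simplex_subproof m n (f : 'I_m.+1 -> 'I_n.+1) (t : simplex m) :
  \row_j (\sum_(i | f i == j) (set_val t : 'rV[R]__) ord0 i) \in simplex n.
Proof.
have [t0 t1] := set_valP t; apply/mem_set; split.
  by move=> j; rewrite mxE sumr_ge0.
rewrite -[RHS]t1 [RHS](partition_big f xpredT) //=.
by apply: eq_bigr => j _; rewrite mxE.
Qed.

Definition push_simplex m n (f : 'I_m.+1 -> 'I_n.+1) (t : simplex m) :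
  simplex n := simplex_point (push_simplex_subproof f t).

Variable B : simplicial_space R.

Definition cell_space (n : nat) : topologicalType := (B n * simplex n)%type.

Definition total_cells : topologicalType := {n & cell_space n}.

Variant glued : total_cells -> total_cells -> Prop :=
  Glued m n (f : {omorphism 'I_m.+1 -> 'I_n.+1}) (b : B n) (t : simplex m) of
    injective f :
    glued (existT cell_space m (act B f b, t))
          (existT cell_space n (b, push_simplex f t)).

(* The fat realization (gluing along the injective maps only).  It agrees with
   the usual one up to homotopy when the degeneracies are cofibrations; without
   such a condition, it is the one for which B_1 is equivalent to the loops on
   the realization of a reduced Segal space B (Segal, 1974). *)
Definition realization : topologicalType :=
  quotient_topology {eq_quot (gen_equiv glued)}.

Definition to_realization n (b : B n) (t : simplex n) : realization :=
  \pi_realization (existT cell_space n (b, t)).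

Lemma vertex_point_subproof : (const_mx 1 : 'rV[R]_1) \in simplex 0.
Proof.
by apply/mem_set; split=> [i|]; rewrite ?big_ord1 mxE // ler01.
Qed.

Definition vertex (b : B 0%N) : realization :=
  to_realization b (simplex_point vertex_point_subproof).

Lemma edge_point_subproof (s : unit_itv R) :
  \row_(j < 2) (if j == ord0 then 1 - (set_val s : R) else set_val s)
    \in simplex 1.
Proof.
have := set_valP s; rewrite /= in_itv /= => /andP[s0 s1].
apply/mem_set; split=> [i|].
  by rewrite mxE; case: ifP => _ //; rewrite subr_ge0.
by rewrite big_ord_recl big_ord1 !mxE /= subrK.
Qed.

(* It runs from the vertex d_1 b to the vertex d_0 b. *)
Definition edge (b : B 1%N) (s : unit_itv R) : realization :=
  to_realization b (simplex_point (edge_point_subproof s)).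

End realization.

Section loop_spaces.
Variable R : realType.

(* It carries the compact-open topology. *)
Definition loop_space (Y : topologicalType) (y : Y) : topologicalType :=
  {path unit_itv R from y to y}.

Section loop_map.
Variables (Y Z : topologicalType) (y : Y) (z : Z) (g : continuousType Y Z).
Hypothesis gy : g y = z.
Variable p : loop_space y.

Lemma loop_map_continuous : continuous (g \o (p : unit_itv R -> Y)).
Proof. exact: cts_fun. Qed.

Lemma loop_map_zero : (g \o (p : unit_itv R -> Y)) zero = z.
Proof. by rewrite /= path_zero. Qed.

Lemma loop_map_one : (g \o (p : unit_itv R -> Y)) one = z.
Proof. by rewrite /= path_one. Qed.

Definition loop_map : loop_space z :=
  mk_path loop_map_continuous loop_map_zero loop_map_one.

End loop_map.

(* The natural map B_1 -> Omega |B|, for B_0 contractible and |B| based at the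
   vertex b0: the loop [eta b] is obtained from the path [edge b] by moving its
   end points d_1 b and d_0 b to b0 along paths [u (b, -)], [v (b, -)] in B_0
   that depend continuously on b.  Such an [eta] exists and is unique up to
   homotopy because B_0 is contractible. *)
Definition natural_map (B : simplicial_space R) (b0 : B 0%N)
    (eta : B 1%N -> loop_space (vertex b0)) : Prop :=
  continuous eta /\
  exists (K : B 1%N * unit_itv R * unit_itv R -> realization B)
         (u v : B 1%N * unit_itv R -> B 0%N),
  [/\ continuous K, continuous u & continuous v] /\
  forall b,
  [/\ u (b, zero) = b0 /\ u (b, one) = face B ord_max b,
      v (b, zero) = b0 /\ v (b, one) = face B ord0 b,
      forall s, K (b, zero, s) = (eta b : unit_itv R -> realization B) s,
      forall s, K (b, one, s) = edge b s &
      forall r, K (b, r, zero) = vertex (u (b, r)) /\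
                K (b, r, one) = vertex (v (b, r))].

(* The two ways in which a space S is regarded as having the homotopy type of a
   loop space: by a homotopy equivalence S -> Omega Y, or by a homotopy
   equivalence B_1 -> S from a reduced Segal space B, through the natural
   homotopy equivalence B_1 -> Omega |B|. *)
Inductive loop_structure (S : topologicalType) : Type :=
| LoopOf (Y : cw_space R) (y : Y) (e : S -> loop_space y)
| LoopSegal (B : simplicial_space R) (h : B 1%N -> S).

Definition is_loop_structure (S : topologicalType) (sigma : loop_structure S) :
    Prop :=
  match sigma with
  | LoopOf Y y e => connected [set: Y] /\ homotopy_equivalence R e
  | LoopSegal B h => reduced_segal B /\ homotopy_equivalence R h
  end.

Inductive delooping (S : topologicalType) : loop_structure S ->
    forall (Z : topologicalType) (z : Z), (S -> loop_space z) -> Prop :=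
| DeloopOf (Y : cw_space R) (y : Y) (e : S -> loop_space y) :
    delooping (LoopOf e) e
| DeloopSegal (B : simplicial_space R) (h : B 1%N -> S) (h' : S -> B 1%N)
    (b0 : B 0%N) (eta : B 1%N -> loop_space (vertex b0)) of
    homotopy_inverse R h h' & natural_map eta :
    delooping (LoopSegal h) (eta \o h').

Definition loop_equivalence (S S' : topologicalType)
    (sigma : loop_structure S) (sigma' : loop_structure S') (f : S -> S') :
    Prop :=
  homotopy_equivalence R f /\
  exists (Z Z' : topologicalType) (z : Z) (z' : Z')
         (k : S -> loop_space z) (k' : S' -> loop_space z')
         (g : continuousType Z Z') (gz : g z = z'),
  [/\ delooping sigma k, delooping sigma' k' &
      homotopic R (k' \o f) (loop_map gz \o k)].

End loop_spaces.

Section homotopy_actions.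
Variable R : realType.

Definition segal_loop_structure (B : simplicial_space R) :
  loop_structure R (B 1%N) := LoopSegal (idfun : B 1%N -> B 1%N).

Record reduced_segal_for (B : simplicial_space R) (S : cw_space R)
    (sigma : loop_structure R S) (f : continuousType (B 1%N) S) : Prop :=
  ReducedSegalFor {
    segal_for_segal : reduced_segal B;
    segal_for_structure : is_loop_structure sigma;
    segal_for_equivalence :
      loop_equivalence (segal_loop_structure B) sigma f }.

(* d_1 ... d_n and d_0 ... d_0 (n factors). *)
Fixpoint front (A : simplicial_space R) n : A n -> A 0%N :=
  if n is m.+1 then fun a => front (face A (@ord_max m.+1) a) else idfun.

Fixpoint back (A : simplicial_space R) n : A n -> A 0%N :=
  if n is m.+1 then fun a => back (face A (@ord0 m.+1) a) else idfun.

Record homotopy_action (A B : simplicial_space R) (q : simplicial_map A B)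
    (X S : cw_space R) (sigma : loop_structure R S)
    (f : continuousType (B 1%N) S) : Prop := HomotopyAction {
  action_space : homotopy_equivalent R (A 0%N) X;
  action_segal : reduced_segal_for sigma f;
  action_front : forall n, homotopy_equivalence R
    (fun a : A n => (front a, q n a) : A 0%N * B n);
  action_back : forall n, homotopy_equivalence R
    (fun a : A n => (back a, q n a) : A 0%N * B n) }.

Definition loop_space_structure (Y : cw_space R) (y : Y) :
  loop_structure R (loop_space R y) := LoopOf (idfun : loop_space R y -> _).

End homotopy_actions.

(* Main.v *)
(** An HM functor preserves the defining equivalences of a homotopy action: the
    products that occur are already equivalent to levels of [A] and [B], hence
    have CW type.  The point is that [pi_0 (L B_1)] is a group.  As [L] does not
    act on [pi_0], inverses must come from a map [B_1 -> B_2] that fills in,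
    continuously in [c], a triangle whose last two edges are [c] and a constant.
    It is obtained by transporting inversion of loops along [f : B_1 -> Omega Y],
    which is multiplicative up to homotopy because the natural map
    [B_1 -> Omega |B|] is: the triangle of [|B|] spanned by [b : B_2] is a
    homotopy between the edge [d_1 b] and the concatenation of [d_2 b] and
    [d_0 b].  These homotopies are handled in the groupoid of path families
    [W * R -> Z], constant for parameters outside [0, 1]. *)
From HB Require Import structures.
Require Import Defs.
From Stdlib Require Import Relation_Operators Operators_Properties.
From mathcomp Require Import all_boot all_order all_algebra.
From mathcomp Require Import all_classical all_reals all_analysis homotopy.
From mathcomp Require Import ring lra generic_quotient.

Set Implicit Arguments.
Unset Strict Implicit.
Unset Printing Implicit Defensive.

Import Order.TTheory GRing.Theory Num.Theory.
Import numFieldNormedType.Exports.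

Local Open Scope classical_set_scope.
Local Open Scope ring_scope.
Local Open Scope quotient_scope.

(** A point of L B_1 need not come from a point of B_1, so pointwise facts about B, such as the
    group law on its components, say nothing about L B: only maps between levels, and homotopies
    between such maps, can be transported. Homotopies survive because L turns the projection of a
    cylinder into a homotopy equivalence. This is why paths and loops carry a parameter space
    throughout: multiplicativity is needed as a single homotopy over B_2, continuous in the
    triangle. On components, the Segal condition for L B already yields an associative product with
    unit; what has to be produced is one map giving left inverses, and these suffice for a group.
    Inversion is borrowed from Omega Y because [f] is a homotopy equivalence by hypothesis, so that
    a homotopy between loops can be brought back to B_1 by a homotopy inverse of [f]; the
    realization serves to compare the faces of a triangle with concatenation. *)

Section continuity.
Variables (X Y Z : topologicalType).

Lemma id_cts : continuous (fun x : X => x).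
Proof. by move=> x; exact: cvg_id. Qed.

Lemma app_cts (g : Y -> Z) (f : X -> Y) :
  continuous g -> continuous f -> continuous (fun x => g (f x)).
Proof. by move=> cg cf x; apply: (continuous_comp (cf x)); exact: cg. Qed.

Lemma pair_cts (f : X -> Y) (g : X -> Z) :
  continuous f -> continuous g -> continuous (fun x => (f x, g x)).
Proof. by move=> cf cg x; apply: cvg_pair; [exact: cf|exact: cg]. Qed.

End continuity.

Section real_continuity.
Variables (R : realType) (X : topologicalType) (f g : X -> R).
Hypotheses (cf : continuous f) (cg : continuous g).

Lemma add_cts : continuous (fun x => f x + g x).
Proof. by move=> x; apply: cvgD; [exact: cf|exact: cg]. Qed.

Lemma opp_cts : continuous (fun x => - f x).
Proof. by move=> x; apply: cvgN; exact: cf. Qed.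

Lemma mul_cts : continuous (fun x => f x * g x).
Proof. by move=> x; apply: cvgM; [exact: cf|exact: cg]. Qed.

Lemma max_cts : continuous (fun x => Num.max (f x) (g x)).
Proof. by move=> x; apply: continuous_max; [exact: cf|exact: cg]. Qed.

Lemma min_cts : continuous (fun x => Num.min (f x) (g x)).
Proof. by move=> x; apply: continuous_min; [exact: cf|exact: cg]. Qed.

End real_continuity.

(** Second-order patterns such as [@?f x] read the factorization of a function off its body.
    Continuity of a map that is not bundled is looked up in the context, which is why many proofs
    begin with an anonymous [have ? := ...]. *)
Ltac cts_step := match goal with
  | H : ?P |- ?P => exact: H
  | |- continuous (fun x => x) => exact: id_cts
  | |- continuous (fun x => ?c) => exact: cst_continuous
  | |- continuous (@fst _ _) => exact: fst_continuous
  | |- continuous (@snd _ _) => exact: snd_continuous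
  | |- continuous (fun x => (_, _)) => apply: pair_cts
  | |- continuous (fun x => fst (@?f x)) =>
    apply: (app_cts (@fst_continuous _ _) (f := f))
  | |- continuous (fun x => snd (@?f x)) =>
    apply: (app_cts (@snd_continuous _ _) (f := f))
  | |- continuous (fun x => @?f x + @?g x) => apply: (add_cts (f := f) (g := g))
  | |- continuous (fun x => - @?f x) => apply: (opp_cts (f := f))
  | |- continuous (fun x => @?f x * @?g x) => apply: (mul_cts (f := f) (g := g))
  | |- continuous (fun x => Num.max (@?f x) (@?g x)) =>
    apply: (max_cts (f := f) (g := g))
  | |- continuous (fun x => Num.min (@?f x) (@?g x)) =>
    apply: (min_cts (f := f) (g := g))
  | H : continuous ?g |- continuous (fun x => ?g (@?f x)) =>
    apply: (app_cts (f := f) H)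
  | |- continuous (fun x => ?g (@?f x)) =>
    apply: (app_cts (f := f) (@cts_fun _ _ g))
  | |- continuous _ => exact: cts_fun
  end.
Ltac cts := repeat cts_step.

(** * Pasting of maps, and the retraction of the line onto the unit interval *)

Section gluing.
Variables (R : realType) (V Z : topologicalType).

(** Preimages of closed sets are used because the half where [h] is positive is not closed:
    agreement on the zero set allows it to be enlarged to [0 <= h], and the preimage becomes a union
    of two closed sets. *)
Lemma glue_cts (h : V -> R) (f g : V -> Z) :
  continuous h -> continuous f -> continuous g ->
  (forall v, h v = 0 -> f v = g v) ->
  continuous (fun v => if h v <= 0 then f v else g v).
Proof.
move=> ch cf cg fg; apply/continuous_closedP => C cC.
rewrite [X in closed X](_ : _ =
  (h @^-1` [set x | x <= 0] `&` f @^-1` C) `|`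
  (h @^-1` [set x | 0 <= x] `&` g @^-1` C)); last first.
  apply/seteqP; split=> v /=.
    by case: ifP => [h0 Cf|/negbT]; [left|rewrite -ltNge => /ltW ? ?; right].
  case=> -[hv]; first by rewrite hv.
  by case: ifP => // hv' Cg; rewrite fg //; apply/le_anti; rewrite hv hv'.
have cP (W : topologicalType) (k : V -> W) := iffLR (@continuous_closedP _ _ k).
apply: closedU; apply: closedI; [|exact: cP|..|exact: cP].
  by apply: (cP _ _ ch); exact: closed_le.
by apply: (cP _ _ ch); exact: closed_ge.
Qed.

End gluing.

Section clamping.
Variable R : realType.

(** The retraction of the line onto [0, 1]. With it paths and homotopies are parametrized by all of
    [R], where affine changes of parameter need no membership proofs. *)
Definition clamp (t : R) : R := Num.max 0 (Num.min 1 t).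

Lemma clamp_itv t : 0 <= clamp t <= 1.
Proof.
by rewrite /clamp le_max lexx /= ge_max ler01 /= ge_min lexx.
Qed.

Lemma clamp_ge0 t : 0 <= clamp t.
Proof. by case/andP: (clamp_itv t). Qed.

Lemma clamp_le1 t : clamp t <= 1.
Proof. by case/andP: (clamp_itv t). Qed.

Lemma clamp_low t : t <= 0 -> clamp t = 0.
Proof. by move=> t0; rewrite /clamp max_l // ge_min t0 orbT. Qed.

Lemma clamp_high t : 1 <= t -> clamp t = 1.
Proof. by move=> t1; rewrite /clamp min_l // max_r. Qed.

Lemma clamp_id t : 0 <= t <= 1 -> clamp t = t.
Proof. by case/andP=> t0 t1; rewrite /clamp min_r // max_r. Qed.

Lemma clamp0 : clamp 0 = 0.
Proof. exact: clamp_low. Qed.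

Lemma clamp1 : clamp 1 = 1.
Proof. exact: clamp_high. Qed.

Lemma clampK t : clamp (clamp t) = clamp t.
Proof. exact: clamp_id (clamp_itv t). Qed.

Lemma clamp_cts : continuous clamp.
Proof. by rewrite /clamp; cts. Qed.

Lemma to_itv_subproof t : clamp t \in (`[0, 1]%classic : set R).
Proof. by rewrite inE /= in_itv /= clamp_itv. Qed.

Definition to_itv (t : R) : unit_itv R := exist _ (clamp t) (to_itv_subproof t).

Definition of_itv (s : unit_itv R) : R := set_val s.

Lemma to_itv_val t : of_itv (to_itv t) = clamp t.
Proof. by rewrite /of_itv set_valE. Qed.

Lemma of_itv_inj : injective of_itv.
Proof. by move=> s t; rewrite /of_itv set_valE => /val_inj. Qed.

Lemma of_itv_itv s : 0 <= of_itv s <= 1.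
Proof. by have := set_valP s; rewrite /= in_itv. Qed.

Lemma of_itvK : cancel of_itv to_itv.
Proof.
by move=> s; apply: of_itv_inj; rewrite to_itv_val clamp_id // of_itv_itv.
Qed.

Lemma of_itv0 : of_itv zero = 0.
Proof. by rewrite /of_itv set_valE. Qed.

Lemma of_itv1 : of_itv one = 1.
Proof. by rewrite /of_itv set_valE. Qed.

Lemma to_itv_low t : t <= 0 -> to_itv t = zero.
Proof.
by move=> t0; apply: of_itv_inj; rewrite to_itv_val of_itv0 clamp_low.
Qed.

Lemma to_itv_high t : 1 <= t -> to_itv t = one.
Proof.
by move=> t0; apply: of_itv_inj; rewrite to_itv_val of_itv1 clamp_high.
Qed.

Lemma of_itv_cts : continuous of_itv.
Proof. exact: initial_continuous. Qed.

Lemma to_itv_cts : continuous to_itv.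
Proof.
apply: (@continuous_comp_initial (unit_itv R) R R of_itv).
rewrite (_ : _ \o _ = clamp); first exact: clamp_cts.
by apply/funext => t /=; rewrite to_itv_val.
Qed.

End clamping.

(** * Homotopies and homotopy equivalences *)

Section homotopies.
Variable R : realType.
Implicit Types X Y Z : topologicalType.

Lemma homotopicP X Y (f g : X -> Y) :
  homotopic R f g <->
  exists2 H : X * R -> Y, continuous H &
    forall x, H (x, 0) = f x /\ H (x, 1) = g x.
Proof.
split=> -[H cH Hfg].
  exists (fun p => H (p.1, to_itv p.2)); last first.
    by move=> x; rewrite /= to_itv_low // to_itv_high.
  by have ? := @to_itv_cts R; cts.
exists (fun p => H (p.1, of_itv p.2)).
  by have ? := @of_itv_cts R; cts.
by move=> x; rewrite /= of_itv0 of_itv1.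
Qed.

Lemma homotopic_ctsl X Y (f g : X -> Y) : homotopic R f g -> continuous f.
Proof.
move=> /homotopicP[H cH Hfg].
by have -> : f = fun x => H (x, 0); [apply/funext => x; case: (Hfg x)|cts].
Qed.

Lemma homotopic_refl X Y (f : X -> Y) : continuous f -> homotopic R f f.
Proof. by move=> cf; apply/homotopicP; exists (fun p => f p.1); [cts|]. Qed.

Lemma homotopic_sym X Y (f g : X -> Y) : homotopic R f g -> homotopic R g f.
Proof.
move=> /homotopicP[H cH Hfg]; apply/homotopicP.
exists (fun p => H (p.1, 1 - p.2)); first by cts.
by move=> x; rewrite /= subr0 subrr; case: (Hfg x).
Qed.

Lemma homotopic_ctsr X Y (f g : X -> Y) : homotopic R f g -> continuous g.
Proof. by move=> /homotopic_sym; exact: homotopic_ctsl. Qed.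

Lemma homotopic_trans X Y (g f h : X -> Y) :
  homotopic R f g -> homotopic R g h -> homotopic R f h.
Proof.
move=> /homotopicP[H cH Hfg] /homotopicP[K cK Kgh]; apply/homotopicP.
exists (fun p => if p.2 - 2^-1 <= 0 then H (p.1, 2 * p.2)
                 else K (p.1, 2 * p.2 - 1)).
  apply: (@glue_cts R (X * R)%type Y (fun p => p.2 - 2^-1) (fun p => H (p.1, 2 * p.2))
    (fun p => K (p.1, 2 * p.2 - 1))); [cts..|].
  move=> [x t] /= /eqP; rewrite subr_eq0 => /eqP ->.
  by rewrite divff // subrr; have [_ ->] := Hfg x; have [-> _] := Kgh x.
move=> x /=; split.
  by rewrite ifT ?mulr0; [case: (Hfg x)|lra].
rewrite ifF; last by apply/negbTE; rewrite -ltNge; lra.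
by rewrite (_ : 2 * 1 - 1 = 1 :> R); [case: (Kgh x)|lra].
Qed.

Lemma homotopic_comp X Y Z (f f' : X -> Y) (g g' : Y -> Z) :
  homotopic R f f' -> homotopic R g g' -> homotopic R (g \o f) (g' \o f').
Proof.
move=> /homotopicP[H cH Hf] /homotopicP[K cK Kg]; apply/homotopicP.
exists (fun p => K (H p, p.2)); first by cts.
by move=> x; have [H0 H1] := Hf x; rewrite H0 H1; have [-> _] := Kg (f x);
  have [_ ->] := Kg (f' x).
Qed.

Lemma homotopic_compl X Y Z (f f' : X -> Y) (g : Y -> Z) : continuous g ->
  homotopic R f f' -> homotopic R (g \o f) (g \o f').
Proof. by move=> /homotopic_refl gg ff'; exact: homotopic_comp. Qed.

Lemma homotopic_compr X Y Z (f : X -> Y) (g g' : Y -> Z) : continuous f ->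
  homotopic R g g' -> homotopic R (g \o f) (g' \o f).
Proof. by move=> /homotopic_refl; exact: homotopic_comp. Qed.

Lemma homotopy_inverse_sym X Y (f : X -> Y) (g : Y -> X) : continuous f ->
  homotopy_inverse R f g -> homotopy_inverse R g f.
Proof. by move=> cf [cg gf fg]; split. Qed.

Lemma homotopy_inverse_comp X Y Z (f : X -> Y) (f' : Y -> X)
    (g : Y -> Z) (g' : Z -> Y) : continuous f -> continuous g ->
  homotopy_inverse R f f' -> homotopy_inverse R g g' ->
  homotopy_inverse R (g \o f) (f' \o g').
Proof.
move=> cf cg [cf' f'f ff'] [cg' g'g gg']; split; first exact: app_cts.
  apply: homotopic_trans f'f.
  apply: (@homotopic_compl _ _ _ ((g' \o g) \o f) f f') => //.
  exact: (@homotopic_compr _ _ _ f (g' \o g) idfun).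
apply: homotopic_trans gg'.
apply: (@homotopic_compl _ _ _ ((f \o f') \o g') g' g) => //.
exact: (@homotopic_compr _ _ _ g' (f \o f') idfun).
Qed.

Lemma homotopy_equivalence_comp X Y Z (f : X -> Y) (g : Y -> Z) :
  homotopy_equivalence R f -> homotopy_equivalence R g ->
  homotopy_equivalence R (g \o f).
Proof.
move=> [cf [f' ff']] [cg [g' gg']]; split; first exact: app_cts.
by exists (f' \o g'); exact: homotopy_inverse_comp.
Qed.

Lemma homotopy_equivalence_inv X Y (f : X -> Y) (g : Y -> X) :
  continuous f -> homotopy_inverse R f g -> homotopy_equivalence R g.
Proof.
move=> cf /[dup] -[cg _ _] fg; split=> //; exists f.
exact: homotopy_inverse_sym.
Qed.

Lemma homeomorphism_equivalence X Y (f : X -> Y) (g : Y -> X) :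
  continuous f -> continuous g -> cancel f g -> cancel g f ->
  homotopy_equivalence R f.
Proof.
move=> cf cg fK gK; split=> //; exists g; split=> //.
  by rewrite (_ : g \o f = idfun); [apply: homotopic_refl; exact: id_cts|exact/funext].
by rewrite (_ : f \o g = idfun); [apply: homotopic_refl; exact: id_cts|exact/funext].
Qed.

Lemma homotopy_equivalence_prodr X Y Z (f : X -> Y) :
  homotopy_equivalence R f ->
  homotopy_equivalence R (fun p : Z * X => (p.1, f p.2)).
Proof.
move=> [cf [g [cg gf fg]]]; split; first by cts.
exists (fun p => (p.1, g p.2)); split; first by cts.
  move/homotopicP: gf => [H cH Hgf]; apply/homotopicP.
  exists (fun p => (p.1.1, H (p.1.2, p.2))); first by cts.
  by move=> [z x] /=; have [-> ->] := Hgf x.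
move/homotopicP: fg => [H cH Hgf]; apply/homotopicP.
exists (fun p => (p.1.1, H (p.1.2, p.2))); first by cts.
by move=> [z x] /=; have [-> ->] := Hgf x.
Qed.

(* A contractible space is only assumed to contract to some point. *)
Lemma contractible_to X (x : X) : contractible R X ->
  homotopic R (cst x) (idfun : X -> X).
Proof.
move=> [x0 c]; apply: (homotopic_trans _ c); apply: homotopic_sym.
exact: (@homotopic_compr _ _ _ (cst x) (cst x0) idfun (@cst_continuous X X x)).
Qed.

Lemma contractible_equivalence X Y (f : X -> Y) :
  continuous f -> contractible R X -> contractible R Y ->
  homotopy_equivalence R f.
Proof.
move=> cf cX cY; split=> //; have [x _] := cX.
exists (cst x); split; first exact: cst_continuous.
  exact: (contractible_to x cX).
exact: (contractible_to (f x) cY).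
Qed.

Lemma cw_type_equivalent X Y (f : X -> Y) :
  homotopy_equivalence R f -> cw_type R Y -> cw_type R X.
Proof.
move=> fE [K KC [g gE]]; exists K => //; exists (g \o f).
exact: homotopy_equivalence_comp.
Qed.

Lemma cw_type_equivalent_inv X Y (f : X -> Y) :
  homotopy_equivalence R f -> cw_type R X -> cw_type R Y.
Proof.
move=> [cf [g gf]] CX; apply: cw_type_equivalent CX.
exact: homotopy_equivalence_inv gf.
Qed.

End homotopies.

(** * The groupoid of path families *)

Section path_families.
Variable R : realType.
Implicit Types W Z : topologicalType.

Definition path_family W Z (a : W * R -> Z) : Prop :=
  [/\ continuous a, forall w t, t <= 0 -> a (w, t) = a (w, 0) &
      forall w t, 1 <= t -> a (w, t) = a (w, 1)].

(** The ends are fixed only for [r] in [0, 1], so that affine formulas in [r] serve as they stand;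
    where a condition must hold for every [r], the parameter is clamped. *)
Definition path_homotopic W Z (a b : W * R -> Z) : Prop :=
  [/\ path_family a, path_family b &
   exists2 H : W * R * R -> Z, continuous H &
    [/\ forall w t, H (w, 0, t) = a (w, t),
        forall w t, H (w, 1, t) = b (w, t),
        forall w r, 0 <= r <= 1 -> H (w, r, 0) = a (w, 0) &
        forall w r, 0 <= r <= 1 -> H (w, r, 1) = a (w, 1)]].

(** The test compares a function with 0, the shape required by [glue_cts]. *)
Definition path_cat W Z (a b : W * R -> Z) (p : W * R) : Z :=
  if p.2 - 2^-1 <= 0 then a (p.1, 2 * p.2) else b (p.1, 2 * p.2 - 1).

Definition path_rev W Z (a : W * R -> Z) (p : W * R) : Z := a (p.1, 1 - p.2).

Definition path_pull W W' Z (u : W' -> W) (a : W * R -> Z) (p : W' * R) : Z :=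
  a (u p.1, p.2).

Lemma path_family_clamp W Z (a : W * R -> Z) w t :
  path_family a -> a (w, clamp t) = a (w, t).
Proof.
case=> _ a0 a1; have [t0|/ltW t0] := lerP t 0.
  by rewrite clamp_low // a0 // [RHS]a0.
have [t1|/ltW t1] := lerP t 1; first by rewrite clamp_id // t0.
by rewrite clamp_high // [RHS]a1.
Qed.

Lemma path_family_of_clamp W Z (G : W * R -> Z) : continuous G ->
  path_family (fun p => G (p.1, clamp p.2)).
Proof.
move=> cG; have ? := @clamp_cts R; split; first by cts.
  by move=> w t t0 /=; rewrite !clamp_low.
by move=> w t t1 /=; rewrite !clamp_high.
Qed.

Lemma path_cat0 W Z (a b : W * R -> Z) w : path_cat a b (w, 0) = a (w, 0).
Proof. by rewrite /path_cat /= ifT ?mulr0 //; lra. Qed.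

Lemma path_cat1 W Z (a b : W * R -> Z) w : path_cat a b (w, 1) = b (w, 1).
Proof.
rewrite /path_cat /= ifF; last by apply/negbTE; rewrite -ltNge; lra.
by rewrite (_ : 2 * 1 - 1 = 1 :> R) //; lra.
Qed.

Lemma path_cat_cts W Z (a b : W * R -> Z) :
  continuous a -> continuous b -> (forall w, a (w, 1) = b (w, 0)) ->
  continuous (path_cat a b).
Proof.
move=> ca cb ab.
apply: (@glue_cts R (W * R)%type Z (fun p => p.2 - 2^-1) (fun p => a (p.1, 2 * p.2))
    (fun p => b (p.1, 2 * p.2 - 1))); [cts..|].
move=> [x t] /= /eqP; rewrite subr_eq0 => /eqP ->.
by rewrite divff // subrr.
Qed.

Lemma path_cat_family W Z (a b : W * R -> Z) :
  path_family a -> path_family b -> (forall w, a (w, 1) = b (w, 0)) ->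
  path_family (path_cat a b).
Proof.
move=> [ca a0 a1] [cb b0 b1] ab; split; first exact: path_cat_cts.
  move=> w t t0; rewrite path_cat0 /path_cat /= ifT; last by lra.
  by apply: a0; lra.
move=> w t t1; rewrite path_cat1 /path_cat /= ifF.
  by apply: b1; lra.
by apply/negbTE; rewrite -ltNge; lra.
Qed.

Lemma path_rev_family W Z (a : W * R -> Z) :
  path_family a -> path_family (path_rev a).
Proof.
move=> [ca a0 a1]; split; first by rewrite /path_rev; cts.
  by move=> w t t0; rewrite /path_rev /= subr0 a1 //; lra.
by move=> w t t1; rewrite /path_rev /= subrr a0 //; lra.
Qed.

Lemma path_rev0 W Z (a : W * R -> Z) w : path_rev a (w, 0) = a (w, 1).
Proof. by rewrite /path_rev /= subr0. Qed.

Lemma path_rev1 W Z (a : W * R -> Z) w : path_rev a (w, 1) = a (w, 0).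
Proof. by rewrite /path_rev /= subrr. Qed.

Lemma path_revK W Z (a : W * R -> Z) : path_rev (path_rev a) = a.
Proof.
by apply/funext => -[w t]; rewrite /path_rev /= opprB addrC subrK.
Qed.

Lemma path_pull_family W W' Z (u : W' -> W) (a : W * R -> Z) :
  continuous u -> path_family a -> path_family (path_pull u a).
Proof.
move=> cu [ca a0 a1]; split; first by rewrite /path_pull; cts.
  by move=> w t; exact: a0.
by move=> w t; exact: a1.
Qed.

Lemma path_push_family W Z Z' (g : Z -> Z') (a : W * R -> Z) :
  continuous g -> path_family a -> path_family (g \o a).
Proof.
move=> cg [ca a0 a1]; split; first exact: app_cts.
  by move=> w t t0 /=; rewrite a0.
by move=> w t t1 /=; rewrite a1.
Qed.

Lemma path_homotopic0 W Z (a b : W * R -> Z) w :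
  path_homotopic a b -> a (w, 0) = b (w, 0).
Proof.
by case=> _ _ [H _ [_ H1 H0 _]]; rewrite -H1 H0 // ler01 lexx.
Qed.

Lemma path_homotopic1 W Z (a b : W * R -> Z) w :
  path_homotopic a b -> a (w, 1) = b (w, 1).
Proof.
by case=> _ _ [H _ [_ H1 _ H0]]; rewrite -H1 H0 // ler01 lexx.
Qed.

Lemma path_homotopic_refl W Z (a : W * R -> Z) :
  path_family a -> path_homotopic a a.
Proof.
move=> /[dup] pa [ca _ _]; split=> //.
by exists (fun p => a (p.1.1, p.2)); first by cts.
Qed.

Lemma path_homotopic_sym W Z (a b : W * R -> Z) :
  path_homotopic a b -> path_homotopic b a.
Proof.
move=> /[dup] ab [pa pb [H cH [Ha Hb H0 H1]]]; split=> //.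
exists (fun p => H (p.1.1, 1 - p.1.2, p.2)); first by cts.
split=> [w t|w t|w r rI|w r rI] /=; rewrite ?subr0 ?subrr //.
  by rewrite H0 ?(path_homotopic0 _ ab) //; lra.
by rewrite H1 ?(path_homotopic1 _ ab) //; lra.
Qed.

Lemma path_homotopic_trans W Z (b a c : W * R -> Z) :
  path_homotopic a b -> path_homotopic b c -> path_homotopic a c.
Proof.
move=> /[dup] ab [pa pb [H cH [Ha Hb H0 H1]]] [_ pc [K cK [Kb Kc K0 K1]]].
split=> //.
exists (fun p => if p.1.2 - 2^-1 <= 0 then H (p.1.1, 2 * p.1.2, p.2)
                 else K (p.1.1, 2 * p.1.2 - 1, p.2)).
  apply: (@glue_cts R (W * R * R)%type Z (fun p => p.1.2 - 2^-1)
    (fun p => H (p.1.1, 2 * p.1.2, p.2))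
    (fun p => K (p.1.1, 2 * p.1.2 - 1, p.2))); [cts..|].
  move=> [[x r] t] /= /eqP; rewrite subr_eq0 => /eqP ->.
  by rewrite divff // subrr Hb Kb.
split=> [w t|w t|w r rI|w r rI] /=.
- by rewrite ifT ?mulr0 //; lra.
- rewrite ifF; last by apply/negbTE; rewrite -ltNge; lra.
  by rewrite (_ : 2 * 1 - 1 = 1 :> R) //; lra.
- case: ifP => [rh|/negbT]; first by rewrite H0 //; lra.
  by rewrite -ltNge => rh; rewrite K0 ?(path_homotopic0 _ ab) //; lra.
- case: ifP => [rh|/negbT]; first by rewrite H1 //; lra.
  by rewrite -ltNge => rh; rewrite K1 ?(path_homotopic1 _ ab) //; lra.
Qed.

Lemma path_homotopic_pull W W' Z (u : W' -> W) (a b : W * R -> Z) :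
  continuous u -> path_homotopic a b ->
  path_homotopic (path_pull u a) (path_pull u b).
Proof.
move=> cu [pa pb [H cH [Ha Hb H0 H1]]]; split; [exact: path_pull_family..|].
exists (fun p => H (u p.1.1, p.1.2, p.2)); first by cts.
by split=> [w t|w t|w r rI|w r rI] /=; rewrite ?Ha ?Hb ?H0 ?H1.
Qed.

Lemma path_homotopic_push W Z Z' (g : Z -> Z') (a b : W * R -> Z) :
  continuous g -> path_homotopic a b -> path_homotopic (g \o a) (g \o b).
Proof.
move=> cg [pa pb [H cH [Ha Hb H0 H1]]]; split; [exact: path_push_family..|].
exists (g \o H); first exact: app_cts.
by split=> [w t|w t|w r rI|w r rI] /=; rewrite ?Ha ?Hb ?H0 ?H1.
Qed.

Lemma path_push_cat W Z Z' (g : Z -> Z') (a b : W * R -> Z) :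
  g \o path_cat a b = path_cat (g \o a) (g \o b).
Proof. by apply/funext => p; rewrite /path_cat /=; case: ifP. Qed.

Lemma path_homotopic_cat W Z (a a' b b' : W * R -> Z) :
  path_homotopic a a' -> path_homotopic b b' ->
  (forall w, a (w, 1) = b (w, 0)) ->
  path_homotopic (path_cat a b) (path_cat a' b').
Proof.
move=> /[dup] aa' [pa pa' [H cH [Ha Ha' H0 H1]]].
move=> /[dup] bb' [pb pb' [K cK [Kb Kb' K0 K1]]] ab; split.
- exact: path_cat_family.
- apply: path_cat_family => // w.
  by rewrite -(path_homotopic1 w aa') -(path_homotopic0 w bb').
have ? := @clamp_cts R.
(* A homotopy is itself a family of paths, over [W * R], so homotopies are concatenated by
   [path_cat] too. Clamping [r] makes the ends meet for every [r]. *)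
pose H' (p : W * R * R) := H (p.1.1, clamp p.1.2, p.2).
pose K' (p : W * R * R) := K (p.1.1, clamp p.1.2, p.2).
exists (path_cat H' K').
  apply: path_cat_cts; [by rewrite /H'; cts|by rewrite /K'; cts|].
  move=> [w r]; rewrite /H' /K' /=.
  by rewrite H1 ?K0 ?clamp_itv.
split=> [w t|w t|w r rI|w r rI].
- by rewrite /path_cat /H' /K' /= clamp0 Ha Kb.
- by rewrite /path_cat /H' /K' /= clamp1 Ha' Kb'.
- by rewrite !path_cat0 /H' /= H0 // clamp_itv.
- by rewrite !path_cat1 /K' /= K1 // clamp_itv.
Qed.

(* The straight-line homotopy between two paths in the plane with the same
   ends; all the groupoid laws below are instances. *)
Lemma path_homotopic_linear W Z (G : W * (R * R) -> Z) (a b : R -> R * R) :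
  continuous G -> continuous a -> continuous b -> a 0 = b 0 -> a 1 = b 1 ->
  (forall t, a (clamp t) = a t) -> (forall t, b (clamp t) = b t) ->
  path_homotopic (fun p => G (p.1, a p.2)) (fun p => G (p.1, b p.2)).
Proof.
move=> cG ca cb ab0 ab1 aK bK.
have family (c : R -> R * R) : continuous c -> (forall t, c (clamp t) = c t) ->
    path_family (fun p : W * R => G (p.1, c p.2)).
  move=> cc cK; split; first by cts.
    by move=> w t t0 /=; rewrite -cK clamp_low.
  by move=> w t t0 /=; rewrite -cK clamp_high.
split; [exact: family..|].
exists (fun p => G (p.1.1,
  ((1 - p.1.2) * (a p.2).1 + p.1.2 * (b p.2).1,
   (1 - p.1.2) * (a p.2).2 + p.1.2 * (b p.2).2))); first by cts.
have lin (r : R) (x : R * R) : ((1 - r) * x.1 + r * x.1, (1 - r) * x.2 + r * x.2) = x.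
  by rewrite -!mulrDl subrK !mul1r; case: x.
split=> [w t|w t|w r rI|w r rI] /=.
- by rewrite subr0 !mul1r !mul0r !addr0; case: (a t).
- by rewrite subrr !mul1r !mul0r !add0r; case: (b t).
- by rewrite -ab0 lin.
- by rewrite -ab1 lin.
Qed.

Lemma path_homotopic_reparam W Z (G : W * R -> Z) (a b : R -> R) :
  continuous G -> continuous a -> continuous b -> a 0 = b 0 -> a 1 = b 1 ->
  (forall t, a (clamp t) = a t) -> (forall t, b (clamp t) = b t) ->
  path_homotopic (fun p => G (p.1, a p.2)) (fun p => G (p.1, b p.2)).
Proof.
move=> cG ca cb ab0 ab1 aK bK.
apply: (@path_homotopic_linear _ _ (fun p => G (p.1, p.2.1))
  (fun t => (a t, 0)) (fun t => (b t, 0))); [by cts..| | | |].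
- by rewrite ab0.
- by rewrite ab1.
- by move=> t; rewrite aK.
- by move=> t; rewrite bK.
Qed.

Lemma path_cat_constl W Z (a : W * R -> Z) :
  path_family a -> path_homotopic (path_cat (fun p => a (p.1, 0)) a) a.
Proof.
move=> /[dup] pa [ca a0 a1]; have ? := @clamp_cts R.
(* Both sides reparametrize [a]: the concatenation waits at 0 until t = 1/2 and then runs at double
   speed. The inner [clamp] makes the parameter constant outside [0, 1]. *)
have := @path_homotopic_reparam _ _ a (fun t => clamp (2 * clamp t - 1)) (@clamp R) ca.
set l := fun p : W * R => a _; set r := fun p : W * R => a _.
have -> : l = path_cat (fun p => a (p.1, 0)) a.
  apply/funext => -[w t]; rewrite /l /path_cat /= path_family_clamp //.
  have [t0|/ltW t0] := lerP t 0.
    by rewrite clamp_low // ifT ?a0 //; lra.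
  have [t1|/ltW t1] := lerP t 1.
    by rewrite clamp_id ?t0 //; case: ifP => // h; rewrite a0 //; lra.
  rewrite clamp_high // ifF; last by apply/negbTE; rewrite -ltNge; lra.
  by rewrite a1 ?[RHS]a1 //; lra.
have -> : r = a by apply/funext => -[w t]; rewrite /r path_family_clamp.
apply; [by cts..| | | |].
- by rewrite clamp0 mulr0 clamp_low //; lra.
- by rewrite clamp1 clamp_high //; lra.
- by move=> t; rewrite clampK.
- by move=> t; rewrite clampK.
Qed.

Lemma path_cat_constr W Z (a : W * R -> Z) :
  path_family a -> path_homotopic (path_cat a (fun p => a (p.1, 1))) a.
Proof.
move=> /[dup] pa [ca a0 a1]; have ? := @clamp_cts R.
have := @path_homotopic_reparam _ _ a (fun t => clamp (2 * clamp t)) (@clamp R) ca.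
set l := fun p : W * R => a _; set r := fun p : W * R => a _.
have -> : l = path_cat a (fun p => a (p.1, 1)).
  apply/funext => -[w t]; rewrite /l /path_cat /= path_family_clamp //.
  have [t0|/ltW t0] := lerP t 0.
    by rewrite clamp_low // mulr0 ifT ?[RHS]a0 //; lra.
  have [t1|/ltW t1] := lerP t 1.
    rewrite clamp_id ?t0 //; case: ifP => // /negbT; rewrite -ltNge => h.
    by rewrite a1 //; lra.
  rewrite clamp_high // ifF; last by apply/negbTE; rewrite -ltNge; lra.
  by rewrite a1 //; lra.
have -> : r = a by apply/funext => -[w t]; rewrite /r path_family_clamp.
apply; [by cts..| | | |].
- by rewrite clamp0 mulr0 clamp0.
- by rewrite clamp1 clamp_high //; lra.
- by move=> t; rewrite clampK.
- by move=> t; rewrite clampK.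
Qed.

Lemma path_cat_revl W Z (a : W * R -> Z) : path_family a ->
  path_homotopic (path_cat (path_rev a) a) (fun p => a (p.1, 1)).
Proof.
move=> /[dup] pa [ca a0 a1]; have ? := @clamp_cts R.
(* The maximum is the absolute value of 2t - 1: the parameter goes from 1 down to 0 and back to 1,
   and is deformed to the constant 1. *)
have := @path_homotopic_reparam _ _ a
  (fun t => Num.max (1 - 2 * clamp t) (2 * clamp t - 1)) (fun=> 1) ca.
set l := fun p : W * R => a _.
have -> : l = path_cat (path_rev a) a.
  apply/funext => -[w t]; rewrite /l /path_cat /path_rev /=.
  have [t0|/ltW t0] := lerP t 0.
    rewrite clamp_low // mulr0 ifT; last by lra.
    by rewrite max_l ?a1 ?[RHS]a1 //; lra.
  have [t1|/ltW t1] := lerP t 1.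
    rewrite clamp_id ?t0 //; case: ifP => [h|/negbT].
      by rewrite max_l //; lra.
    by rewrite -ltNge => h; rewrite max_r //; lra.
  rewrite clamp_high // ifF; last by apply/negbTE; rewrite -ltNge; lra.
  by rewrite max_r ?a1 ?[RHS]a1 //; lra.
apply=> //; [by cts|by cts| | |].
- by rewrite clamp0 max_l; lra.
- by rewrite clamp1 max_r; lra.
- by move=> t; rewrite clampK.
Qed.

Lemma path_cat_revr W Z (a : W * R -> Z) : path_family a ->
  path_homotopic (path_cat a (path_rev a)) (fun p => a (p.1, 0)).
Proof.
move=> pa; have := path_cat_revl (path_rev_family pa); rewrite path_revK.
by congr path_homotopic; apply/funext => p; rewrite path_rev1.
Qed.

Lemma path_cat_assoc W Z (a b c : W * R -> Z) :
  path_family a -> path_family b -> path_family c ->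
  (forall w, a (w, 1) = b (w, 0)) -> (forall w, b (w, 1) = c (w, 0)) ->
  path_homotopic (path_cat (path_cat a b) c) (path_cat a (path_cat b c)).
Proof.
move=> pa pb pc ab bc; have ? := @clamp_cts R.
(* [G] runs through [a], [b] and [c] in turn over [0, 3]; both bracketings are reparametrizations of
   it. *)
pose G (p : W * R) := if p.2 - 2 <= 0 then
  (if p.2 - 1 <= 0 then a (p.1, p.2) else b (p.1, p.2 - 1))
  else c (p.1, p.2 - 2).
have [[ca _ _] [cb _ _] [cc _ _]] := And3 pa pb pc.
have cG : continuous G.
  apply: (@glue_cts R (W * R)%type Z (fun p => p.2 - 2)
    (fun p => if p.2 - 1 <= 0 then a (p.1, p.2) else b (p.1, p.2 - 1))
    (fun p => c (p.1, p.2 - 2))); [by cts| |by cts|].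
    apply: (@glue_cts R (W * R)%type Z (fun p => p.2 - 1)
      (fun p => a (p.1, p.2)) (fun p => b (p.1, p.2 - 1))); [by cts..|].
    move=> [w t] /= /eqP; rewrite subr_eq0 => /eqP ->.
    by rewrite subrr.
  move=> [w t] /= /eqP; rewrite subr_eq0 => /eqP ->.
  rewrite ifF; last by apply/negbTE; rewrite -ltNge; lra.
  by rewrite subrr (_ : 2 - 1 = 1) //; lra.
(* By t = 1/2 the left bracketing has covered [0, 2] and the right one only [0, 1]. The two broken
   lines, concave and convex, are a minimum and a maximum of their linear pieces. *)
have := @path_homotopic_reparam _ _ G
  (fun t => Num.min (4 * clamp t) (2 * clamp t + 1))
  (fun t => Num.max (2 * clamp t) (4 * clamp t - 1)) cG.
have ifN (x : R) (u v : Z) : 0 < x -> (if x <= 0 then u else v) = v.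
  by rewrite ltNge => /negbTE ->.
set l := fun p : W * R => G _; set r := fun p : W * R => G _.
have -> : l = path_cat (path_cat a b) c.
  apply/funext => -[w t]; rewrite -[RHS]path_family_clamp; last first.
    apply: path_cat_family => //; first exact: path_cat_family.
    by move=> x; rewrite path_cat1.
  rewrite /l /G /path_cat /=; have := clamp_itv t; move: (clamp t) => {}t tI.
  have [h|h] := lerP t 2^-1.
    rewrite min_l; last by lra.
    rewrite [LHS]ifT; last by lra.
    rewrite [RHS]ifT; last by lra.
    have [k|k] := lerP t 4^-1.
      by rewrite !ifT; [congr (a (_, _)); lra|lra..].
    by rewrite !ifN; [congr (b (_, _)); lra|lra..].
  rewrite min_r; last by lra.
  by rewrite !ifN; [congr (c (_, _)); lra|lra..].
have -> : r = path_cat a (path_cat b c).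
  apply/funext => -[w t]; rewrite -[RHS]path_family_clamp; last first.
    apply: path_cat_family => //; first exact: path_cat_family.
    by move=> x; rewrite path_cat0.
  rewrite /r /G /path_cat /=; have := clamp_itv t; move: (clamp t) => {}t tI.
  have [h|h] := lerP t 2^-1.
    rewrite max_l; last by lra.
    by rewrite !ifT; [congr (a (_, _)); lra|lra..].
  rewrite max_r; last by lra.
  rewrite [RHS]ifN; last by lra.
  have [k|k] := lerP t (3 / 4).
    rewrite ifT; last by lra.
    rewrite ifN; last by lra.
    by rewrite ifT; [congr (b (_, _)); lra|lra..].
  by rewrite !ifN; [congr (c (_, _)); lra|lra..].
apply; [by cts..| | | |].
- by rewrite clamp0 !mulr0 min_l ?max_l; lra.
- by rewrite clamp1 min_r ?max_r; lra.
- by move=> t; rewrite clampK.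
- by move=> t; rewrite clampK.
Qed.

Lemma path_cat_cancelr W Z (a b c : W * R -> Z) :
  path_family a -> path_family b ->
  (forall w, a (w, 1) = c (w, 0)) -> (forall w, b (w, 1) = c (w, 0)) ->
  path_family c -> path_homotopic (path_cat a c) (path_cat b c) ->
  path_homotopic a b.
Proof.
have key (d : W * R -> Z) : path_family d -> path_family c ->
    (forall w, d (w, 1) = c (w, 0)) ->
    path_homotopic (path_cat (path_cat d c) (path_rev c)) d.
  move=> pd pc dc; have pr := path_rev_family pc.
  apply: path_homotopic_trans (path_cat_assoc pd pc pr dc _) _ => [w|].
    by rewrite path_rev0.
  apply: path_homotopic_trans (path_cat_constr pd).
  apply: path_homotopic_cat; first exact: path_homotopic_refl.
    have := path_cat_revr pc; congr path_homotopic.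
    by apply/funext => p /=; rewrite dc.
  by move=> w; rewrite path_cat0.
move=> pa pb ac bc pc acbc.
apply: path_homotopic_trans (path_homotopic_sym (key a pa pc ac)) _.
apply: path_homotopic_trans _ (key b pb pc bc).
apply: path_homotopic_cat => //.
  by apply: path_homotopic_refl; exact: path_rev_family.
by move=> w; rewrite path_cat1 path_rev0.
Qed.

Lemma path_cat_cancell W Z (a b c : W * R -> Z) :
  path_family a -> path_family b ->
  (forall w, c (w, 1) = a (w, 0)) -> (forall w, c (w, 1) = b (w, 0)) ->
  path_family c -> path_homotopic (path_cat c a) (path_cat c b) ->
  path_homotopic a b.
Proof.
have key (d : W * R -> Z) : path_family d -> path_family c ->
    (forall w, c (w, 1) = d (w, 0)) ->
    path_homotopic (path_cat (path_rev c) (path_cat c d)) d.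
  move=> pd pc cd; have pr := path_rev_family pc.
  apply: path_homotopic_trans
    (path_homotopic_sym (path_cat_assoc pr pc pd _ cd)) _ => [w|].
    by rewrite path_rev1.
  apply: path_homotopic_trans (path_cat_constl pd).
  apply: path_homotopic_cat; last by move=> w; rewrite path_cat1.
    have := path_cat_revl pc; congr path_homotopic.
    by apply/funext => p /=; rewrite cd.
  exact: path_homotopic_refl.
move=> pa pb ca cb pc cacb.
apply: path_homotopic_trans (path_homotopic_sym (key a pa pc ca)) _.
apply: path_homotopic_trans _ (key b pb pc cb).
apply: path_homotopic_cat => //.
  by apply: path_homotopic_refl; exact: path_rev_family.
by move=> w; rewrite path_cat0 path_rev1.
Qed.

(** The two legs from (0, 0) over (1, 0) to (1, 1) deform linearly to the diagonal in the plane,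
    before [G] is applied. *)
Lemma path_homotopic_triangle W Z (G : W * (R * R) -> Z) : continuous G ->
  path_homotopic
    (path_cat (fun p => G (p.1, (clamp p.2, 0))) (fun p => G (p.1, (1, clamp p.2))))
    (fun p => G (p.1, (clamp p.2, clamp p.2))).
Proof.
move=> cG; have ? := @clamp_cts R.
have := @path_homotopic_linear _ _ G
  (fun t => (clamp (2 * clamp t), clamp (2 * clamp t - 1)))
  (fun t => (clamp t, clamp t)) cG.
set l := fun p : W * R => G _.
have -> : l = path_cat (fun p => G (p.1, (clamp p.2, 0)))
                       (fun p => G (p.1, (1, clamp p.2))).
  apply/funext => -[w t]; rewrite -[RHS]path_family_clamp; last first.
    apply: path_cat_family.
    - by apply: (@path_family_of_clamp _ _ (fun p => G (p.1, (p.2, 0)))); cts.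
    - by apply: (@path_family_of_clamp _ _ (fun p => G (p.1, (1, p.2)))); cts.
    - by move=> x; rewrite clamp1 clamp0.
  rewrite /l /path_cat /=; have := clamp_itv t; move: (clamp t) => {}t tI.
  case: ifP => [h|/negbT].
    by rewrite (@clamp_low _ (_ - 1)) //; lra.
  by rewrite -ltNge => h; rewrite (@clamp_high _ (2 * _)) //; lra.
apply; [by cts..| | | |].
- by rewrite clamp0 mulr0 sub0r clamp0 clamp_low //; lra.
- by rewrite clamp1 !clamp_high //; lra.
- by move=> t; rewrite clampK.
- by move=> t; rewrite clampK.
Qed.

(** Both ways around the square are compared with the diagonal; the second comparison is the first
    one with the coordinates exchanged. *)
Lemma path_homotopic_square W Z (G : W * (R * R) -> Z) : continuous G ->
  path_homotopic
    (path_cat (fun p => G (p.1, (0, clamp p.2))) (fun p => G (p.1, (clamp p.2, 1))))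
    (path_cat (fun p => G (p.1, (clamp p.2, 0))) (fun p => G (p.1, (1, clamp p.2)))).
Proof.
move=> cG; apply: path_homotopic_trans _ (path_homotopic_sym
  (path_homotopic_triangle cG)).
by apply: (@path_homotopic_triangle _ _ (fun p => G (p.1, (p.2.2, p.2.1)))); cts.
Qed.

(* Contracting the target fills, for each of the two families, the square
   whose other sides are the tracks of the end points. *)
Lemma path_homotopic_contractible W Z (a b : W * R -> Z) : contractible R Z ->
  path_family a -> path_family b -> (forall w, a (w, 0) = b (w, 0)) ->
  (forall w, a (w, 1) = b (w, 1)) -> path_homotopic a b.
Proof.
move=> [z0 /homotopicP[C cC HC]] pa pb ab0 ab1; have ? := @clamp_cts R.
pose track (d : W * R -> Z) (s : R) (p : W * R) := C (d (p.1, s), clamp p.2).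
have ptrack d s : path_family d -> path_family (track d s).
  move=> [cd _ _].
  by apply: (@path_family_of_clamp _ _ (fun p => C (d (p.1, s), p.2))); cts.
have key d : path_family d ->
    path_homotopic (path_cat (fun=> z0) (track d 1)) (path_cat (track d 0) d).
  move=> /[dup] pd [cd _ _].
  have := @path_homotopic_square _ _ (fun p => C (d (p.1, p.2.2), p.2.1)).
  set l0 := fun p : W * R => C _; set r1 := fun p : W * R => C _.
  have -> : l0 = (fun=> z0) by apply/funext=> p; rewrite /l0 /=; case: (HC (d (p.1, clamp p.2))).
  set r2 := fun p : W * R => C _; set l3 := fun p : W * R => C _.
  have -> : l3 = d.
    apply/funext => -[w t]; rewrite /l3 /= (HC _).2 /=.
    by rewrite path_family_clamp.
  by apply; cts.
apply: (@path_cat_cancell _ _ a b (track a 0)) => //.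
- by move=> w; rewrite /track /= clamp1 (HC _).2.
- by move=> w; rewrite /track /= clamp1 (HC _).2 /= ab0.
- exact: ptrack.
apply: path_homotopic_trans (path_homotopic_sym (key a pa)) _.
have -> : track a 0 = track b 0.
  by apply/funext => p; rewrite /track ab0.
have -> : track a 1 = track b 1.
  by apply/funext => p; rewrite /track ab1.
exact: key.
Qed.

End path_families.

(** * Maps into a loop space as families of closed paths *)

Section loop_families.
Variable R : realType.
Implicit Types W Y : topologicalType.

Lemma itv_hausdorff : hausdorff_space (unit_itv R).
Proof.
move=> s t st; apply: of_itv_inj; apply: (@Rhausdorff R) => U V nU nV.
have [x [Ux Vx]] := st (@of_itv R @^-1` U) (@of_itv R @^-1` V)
  (@of_itv_cts R s U nU) (@of_itv_cts R t V nV).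
by exists (of_itv x).
Qed.

Lemma itv_compact : compact [set: unit_itv R].
Proof.
rewrite (_ : [set: _] = @to_itv R @` `[0, 1]).
  apply: continuous_compact; last exact: segment_compact.
  by apply: continuous_subspaceT; exact: to_itv_cts.
apply/seteqP; split=> // s _; exists (of_itv s); last exact: of_itvK.
by rewrite /= in_itv; exact: of_itv_itv.
Qed.

Lemma itv_locally_compact : locally_compact [set: unit_itv R].
Proof.
move=> s _; exists setT; first exact: filterT.
by split; [exact: itv_compact|exact: closedT].
Qed.

Definition loop_family W Y (y : Y) (phi : W -> loop_space R y) (p : W * R) : Y :=
  (phi p.1 : unit_itv R -> Y) (to_itv p.2).

Lemma loop_family0 W Y (y : Y) (phi : W -> loop_space R y) w :
  loop_family phi (w, 0) = y.
Proof. by rewrite /loop_family /= to_itv_low // path_zero. Qed.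

Lemma loop_family1 W Y (y : Y) (phi : W -> loop_space R y) w :
  loop_family phi (w, 1) = y.
Proof. by rewrite /loop_family /= to_itv_high // path_one. Qed.

(** Joint continuity is the exponential law for the compact-open topology, which applies because the
    interval is locally compact and Hausdorff. *)
Lemma loop_family_path W Y (y : Y) (phi : W -> loop_space R y) :
  continuous phi -> path_family (loop_family phi).
Proof.
move=> cphi; have ? := @to_itv_cts R; split.
- pose ev (w : W) : unit_itv R -> Y := phi w.
  have cev : continuous (uncurry ev).
    apply: continuous_uncurry.
    + exact: itv_locally_compact.
    + exact: itv_hausdorff.
    + apply: (@app_cts _ _ {compact-open, unit_itv R -> Y}
        (fun p : loop_space R y => (p : unit_itv R -> Y)) phi _ cphi).
      exact: initial_continuous.
    + by move=> w; exact: cts_fun.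
  by apply: (app_cts cev (f := fun p : W * R => (p.1, to_itv p.2))); cts.
- by move=> w t t0; rewrite loop_family0 /loop_family /= to_itv_low // path_zero.
- by move=> w t t0; rewrite loop_family1 /loop_family /= to_itv_high // path_one.
Qed.

Lemma loop_family_inj W W' Y (y : Y) (phi : W -> loop_space R y)
    (psi : W' -> loop_space R y) w w' :
  (forall t, loop_family phi (w, t) = loop_family psi (w', t)) -> phi w = psi w'.
Proof.
move=> e; apply/path_eqP => s.
by have := e (of_itv s); rewrite /loop_family /= of_itvK.
Qed.

(** The other half of the exponential law, currying. Loop-valued maps can thus be given by formulas
    for path families. *)
Lemma loop_family_onto W Y (y : Y) (a : W * R -> Y) : path_family a ->
  (forall w, a (w, 0) = y) -> (forall w, a (w, 1) = y) ->
  exists2 phi : W -> loop_space R y, continuous phi & loop_family phi = a.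
Proof.
move=> /[dup] pa [ca _ _] a0 a1; have ? := @of_itv_cts R.
have cb (w : W) : continuous (fun s : unit_itv R => a (w, of_itv s)) by cts.
have b0 w : a (w, of_itv (zero : unit_itv R)) = y by rewrite of_itv0.
have b1 w : a (w, of_itv (one : unit_itv R)) = y by rewrite of_itv1.
exists (fun w => mk_path (cb w) (b0 w) (b1 w) : {path unit_itv R from y to y}).
  apply: (@continuous_comp_initial _ _ {compact-open, unit_itv R -> Y}).
  apply: (@continuous_curry_fun _ _ _ (fun p : W * unit_itv R => a (p.1, of_itv p.2))).
  by cts.
apply/funext => -[w t]; rewrite /loop_family /= /mk_path /=.
by rewrite to_itv_val path_family_clamp.
Qed.

Lemma loop_family_homotopic W Y (y : Y) (phi psi : W -> loop_space R y) :
  homotopic R phi psi -> path_homotopic (loop_family phi) (loop_family psi).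
Proof.
move=> pp; have [cphi cpsi] := (homotopic_ctsl pp, homotopic_ctsr pp).
have /homotopicP[H cH Hpp] := pp; split; [exact: loop_family_path..|].
exists (loop_family H); first by have [] := loop_family_path cH.
split=> [w t|w t|w r _|w r _]; rewrite ?loop_family0 ?loop_family1 //.
- by rewrite /loop_family /= (Hpp w).1.
- by rewrite /loop_family /= (Hpp w).2.
Qed.

Lemma homotopic_loop_family W Y (y : Y) (phi psi : W -> loop_space R y) :
  path_homotopic (loop_family phi) (loop_family psi) -> homotopic R phi psi.
Proof.
move=> [pphi ppsi [H cH [Hphi Hpsi H0 H1]]]; have ? := @clamp_cts R.
(* Clamping [r] closes the path at every [r], and clamping [t] makes it constant outside [0, 1], so
   [loop_family_onto] applies over [W * R]. *)
pose a (p : W * R * R) := H (p.1.1, clamp p.1.2, clamp p.2).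
have pa : path_family a.
  by apply: (@path_family_of_clamp _ _ _ (fun p : W * R * R => H (p.1.1, clamp p.1.2, p.2))); cts.
have [||K cK Ka] := @loop_family_onto _ _ y a pa.
- by move=> [w r]; rewrite /a /= clamp0 H0 ?clamp_itv // loop_family0.
- by move=> [w r]; rewrite /a /= clamp1 H1 ?clamp_itv // loop_family1.
apply/homotopicP; exists K => // w; split; apply: loop_family_inj => t.
  by rewrite Ka /a /= clamp0 Hphi path_family_clamp.
by rewrite Ka /a /= clamp1 Hpsi path_family_clamp.
Qed.

End loop_families.

(** * Vertices, edges and triangles in the realization *)

Section simplices.
Variable R : realType.

Lemma mx_cts (X Y : topologicalType) m n (f : X -> 'M[Y]_(m, n)) :
  (forall i j, continuous (fun x => f x i j)) -> continuous f.
Proof.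
move=> cf x U [P nP PU]; apply: (@filterS _ _ _ _ _ (fun z => PU (f z))).
apply: filter_forall => i; apply: filter_forall => j.
exact: cf (nP i j).
Qed.

Lemma simplex_cts (X : topologicalType) n (f : X -> simplex (R := R) (n := n)) :
  (forall i, continuous (fun x => (set_val (f x) : 'rV[R]_n.+1) ord0 i)) ->
  continuous f.
Proof.
move=> cf; apply: (@continuous_comp_initial _ _ 'rV[R]_n.+1 set_val).
by apply: mx_cts => i j; rewrite ord1; exact: cf.
Qed.

Lemma simplex_inj n (s t : simplex (R := R) (n := n)) :
  (forall i, (set_val s : 'rV[R]_n.+1) ord0 i = (set_val t : 'rV[R]_n.+1) ord0 i) ->
  s = t.
Proof.
move=> st; apply: val_inj; rewrite -!set_valE; apply/rowP => i; exact: st.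
Qed.

Variable B : simplicial_space R.

Lemma omorphism_eq m n (f g : {omorphism 'I_m.+1 -> 'I_n.+1}) :
  f =1 g -> f = g.
Proof.
case: f g => [f [[f_le]]] [g [[g_le]]] /= /funext fg.
by rewrite fg in f_le *; rewrite (Prop_irrelevance f_le g_le).
Qed.

Lemma act_eq m n (f g : {omorphism 'I_m.+1 -> 'I_n.+1}) (b : B n) :
  f =1 g -> act B f b = act B g b.
Proof. by move=> /omorphism_eq ->. Qed.

Lemma to_realization_cts (X : topologicalType) n (f : X -> B n)
    (g : X -> simplex (R := R) (n := n)) : continuous f -> continuous g ->
  continuous (fun x => to_realization (f x) (g x)).
Proof.
move=> cf cg; apply: (app_cts (@pi_continuous _ _)).
apply: (app_cts (@existT_continuous _ _ n) (f := fun x => (f x, g x))).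
exact: pair_cts.
Qed.

Lemma to_realization_glue m n (f : {omorphism 'I_m.+1 -> 'I_n.+1}) (b : B n)
    (t : simplex (R := R) (n := m)) : injective f ->
  to_realization (act B f b) t = to_realization b (push_simplex f t).
Proof.
move=> f_inj; apply/eqmodP; apply/asboolP; apply: rst_step; exact: Glued.
Qed.

Lemma vertex_cts : continuous (@vertex R B).
Proof. by apply: to_realization_cts; [exact: id_cts|exact: cst_continuous]. Qed.

Lemma edge_cts : continuous (fun p : B 1%N * unit_itv R => edge p.1 p.2).
Proof.
apply: to_realization_cts; first by cts.
have ? := @of_itv_cts R.
apply: simplex_cts => i; rewrite [X in continuous X](_ : _ = fun p =>
    if i == ord0 then 1 - of_itv p.2 else of_itv p.2).
  by case: (i == ord0); cts.
by apply/funext => p; rewrite set_valE /= mxE.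
Qed.

End simplices.

Section edges.
Variables (R : realType) (B : simplicial_space R).

Lemma act_act m n p (f : {omorphism 'I_m.+1 -> 'I_n.+1})
    (g : {omorphism 'I_n.+1 -> 'I_p.+1}) (h : {omorphism 'I_m.+1 -> 'I_p.+1})
    (b : B p) : g \o f =1 h -> act B f (act B g b) = act B h b.
Proof. by move=> gf; rewrite -[LHS](act_comp f g) (act_eq b gf). Qed.

Lemma coface_inj n (i : 'I_n.+2) : injective (coface i).
Proof. exact: lift_inj. Qed.

Lemma inord1_val n : nat_of_ord (inord 1 : 'I_n.+2) = 1%N.
Proof. exact: inordK. Qed.

(* [d_0 d_2 = d_1 d_0], [d_1 d_2 = d_1 d_1] and [d_0 d_0 = d_0 d_1]: the three
   vertices of a triangle. *)
Lemma triangle_vertex1 (b : B 2%N) :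
  face B ord0 (face B ord_max b) = face B ord_max (face B ord0 b).
Proof.
rewrite /face -[RHS](act_comp (coface _) (coface _)); apply: act_act => k.
by apply: val_inj; rewrite (ord1 k).
Qed.

Lemma triangle_vertex0 (b : B 2%N) :
  face B ord_max (face B ord_max b) = face B ord_max (face B (inord 1) b).
Proof.
rewrite /face -[RHS](act_comp (coface _) (coface _)); apply: act_act => k.
by apply: val_inj; rewrite (ord1 k) /= inord1_val.
Qed.

Lemma triangle_vertex2 (b : B 2%N) :
  face B ord0 (face B ord0 b) = face B ord0 (face B (inord 1) b).
Proof.
rewrite /face -[RHS](act_comp (coface _) (coface _)); apply: act_act => k.
by apply: val_inj; rewrite (ord1 k) /= inord1_val.
Qed.

Lemma edge_zero (b : B 1%N) : edge b zero = vertex (face B ord_max b).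
Proof.
rewrite /vertex to_realization_glue; last exact: coface_inj.
congr to_realization; apply: simplex_inj => j.
rewrite !set_valE /= !mxE big_mkcond big_ord1 /= mxE.
by rewrite subr0; case: j => -[|[|]].
Qed.

Lemma edge_one (b : B 1%N) : edge b one = vertex (face B ord0 b).
Proof.
rewrite /vertex to_realization_glue; last exact: coface_inj.
congr to_realization; apply: simplex_inj => j.
rewrite !set_valE /= !mxE big_mkcond big_ord1 /= mxE.
by rewrite subrr; case: j => -[|[|]].
Qed.

Definition edge_family (p : B 1%N * R) : realization B := edge p.1 (to_itv p.2).

Lemma edge_family_path : path_family edge_family.
Proof.
have ? := @to_itv_cts R; split.
- by apply: (app_cts (@edge_cts R B) (f := fun p => (p.1, to_itv p.2))); cts.
- by move=> b t t0; rewrite /edge_family /= !to_itv_low.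
- by move=> b t t0; rewrite /edge_family /= !to_itv_high.
Qed.

(** On 0 <= q <= p <= 1 the barycentric coordinates are 1 - p, p - q, q, and the minimum extends
    them to the square. The side q = 0 is then the face d_2, the side p = 1 is d_0 and the diagonal
    is d_1, as [path_homotopic_triangle] arranges them. *)
Lemma triangle_point_subproof (p q : R) :
  \row_(j < 3) (if j == ord0 then 1 - clamp p
    else if j == ord_max then Num.min (clamp p) (clamp q)
    else clamp p - Num.min (clamp p) (clamp q)) \in simplex (R := R) (n := 2).
Proof.
apply/mem_set; split=> [i|].
  rewrite mxE; case: ifP => _; first by rewrite subr_ge0 clamp_le1.
  case: ifP => _; first by rewrite le_min !clamp_ge0.
  by rewrite subr_ge0 ge_min lexx.
by rewrite !big_ord_recl big_ord0 !mxE /=; ring.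
Qed.

Definition triangle_point (p q : R) := simplex_point (triangle_point_subproof p q).

Lemma triangle_point_cts (X : topologicalType) (f g : X -> R) :
  continuous f -> continuous g -> continuous (fun x => triangle_point (f x) (g x)).
Proof.
move=> cf cg; have ? := @clamp_cts R.
apply: simplex_cts => i; rewrite [X in continuous X](_ : _ = fun x =>
  if i == ord0 then 1 - clamp (f x)
    else if i == ord_max then Num.min (clamp (f x)) (clamp (g x))
    else clamp (f x) - Num.min (clamp (f x)) (clamp (g x))).
  by case: (i == ord0); [|case: (i == ord_max)]; cts.
by apply/funext => p; rewrite set_valE /= mxE.
Qed.

Lemma triangle_face (i : 'I_3) (b : B 2%N) (t p q : R) :
  (forall j : 'I_3, (\sum_(k < 2 | coface i k == j)
     (if k == ord0 then 1 - clamp t else clamp t)) =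
   (if j == ord0 then 1 - clamp p
    else if j == ord_max then Num.min (clamp p) (clamp q)
    else clamp p - Num.min (clamp p) (clamp q))) ->
  to_realization b (triangle_point p q) = edge (face B i b) (to_itv t).
Proof.
move=> pq; rewrite /edge to_realization_glue; last exact: coface_inj.
congr to_realization; apply: simplex_inj => j.
rewrite !set_valE /= !mxE -pq; apply: eq_bigr => k _.
by rewrite !set_valE /= mxE; case: ifP.
Qed.

Lemma edge_family_mul :
  path_homotopic (path_cat (path_pull (face B (@ord_max 2)) edge_family)
                           (path_pull (face B (@ord0 2)) edge_family))
                 (path_pull (face B (inord 1 : 'I_3)) edge_family).
Proof.
have cG : continuous (fun p : B 2%N * (R * R) =>
    to_realization p.1 (triangle_point p.2.1 p.2.2)).
  by apply: to_realization_cts; [|apply: triangle_point_cts]; cts.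
have := path_homotopic_triangle cG.
set l0 := fun p : B 2%N * R => _; set l1 := fun p : B 2%N * R => _.
set l2 := fun p : B 2%N * R => _.
have -> : l0 = path_pull (face B (@ord_max 2)) edge_family.
  apply/funext => -[b t]; apply: triangle_face => j.
  rewrite big_mkcond !big_ord_recl big_ord0 /= clamp0 clampK.
  rewrite min_r ?clamp_ge0 //; case: j => -[|[|[|]]] //= _; rewrite /=; ring.
have -> : l1 = path_pull (face B (@ord0 2)) edge_family.
  apply/funext => -[b t]; apply: triangle_face => j.
  rewrite big_mkcond !big_ord_recl big_ord0 /= clamp1 clampK.
  rewrite min_r ?clamp_le1 //; case: j => -[|[|[|]]] //= _; rewrite /=; ring.
have -> // : l2 = path_pull (face B (inord 1 : 'I_3)) edge_family.
apply/funext => -[b t]; apply: triangle_face => j.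
rewrite big_mkcond !big_ord_recl big_ord0 /= clampK.
rewrite minxx; rewrite -!val_eqE /= inord1_val.
by case: j => -[|[|[|]]] //= _; rewrite /=; ring.
Qed.

End edges.

(** * The natural map to loops on the realization: existence and multiplicativity *)

Section natural_maps.
Variables (R : realType) (B : simplicial_space R) (b0 : B 0%N).
Hypothesis B0 : contractible R (B 0%N).

Lemma natural_map_exists : exists eta, @natural_map R B b0 eta.
Proof.
have /homotopicP[C cC HC] := contractible_to b0 B0.
have [C0 C1] := (fun x => (HC x).1, fun x => (HC x).2).
have [? ? ?] := And3 (@clamp_cts R) (@to_itv_cts R) (@of_itv_cts R).
have ? := @vertex_cts R B.
pose u (b : B 1%N) (t : R) := vertex (C (face B ord_max b, clamp t)).
pose v (b : B 1%N) (t : R) := vertex (C (face B ord0 b, clamp t)).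
(* Three pieces over [0, 3]: the track of d_1 b under the contraction, starting at [b0]; the edge;
   and the track of d_0 b traversed back to [b0]. *)
pose P (p : B 1%N * R) := if p.2 - 1 <= 0 then u p.1 p.2 else
  if p.2 - 2 <= 0 then edge p.1 (to_itv (p.2 - 1)) else v p.1 (3 - p.2).
have cP : continuous P.
  apply: (@glue_cts R (B 1%N * R)%type _ (fun p => p.2 - 1) (fun p => u p.1 p.2)
    (fun p => if p.2 - 2 <= 0 then edge p.1 (to_itv (p.2 - 1)) else v p.1 (3 - p.2))).
  - by cts.
  - by rewrite /u; cts.
  - apply: (@glue_cts R (B 1%N * R)%type _ (fun p => p.2 - 2)
      (fun p => edge p.1 (to_itv (p.2 - 1))) (fun p => v p.1 (3 - p.2))).
    + by cts.
    + by apply: (app_cts (@edge_cts R B) (f := fun p : B 1%N * R => (p.1, to_itv (p.2 - 1)))); cts.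
    + by rewrite /v; cts.
    + move=> [b t] /= /eqP; rewrite subr_eq0 => /eqP ->.
      rewrite to_itv_high ?edge_one /v; last by lra.
      by rewrite clamp_high ?C1 //; lra.
  - move=> [b t] /= /eqP; rewrite subr_eq0 => /eqP ->.
    rewrite ifT; last by lra.
    by rewrite subrr to_itv_low ?edge_zero // /u clamp1 C1.
have Pu b t : t <= 1 -> P (b, t) = u b t by move=> t1; rewrite /P ifT //=; lra.
have Pe b t : 1 <= t <= 2 -> P (b, t) = edge b (to_itv (t - 1)).
  move=> tI; rewrite /P /=; case: ifP => t1; last by rewrite ifT //; lra.
  have -> : t = 1 by lra.
  by rewrite subrr to_itv_low ?edge_zero // /u clamp1 C1.
have Pv b t : 2 <= t -> P (b, t) = v b (3 - t).
  move=> tI; have [t2|t2] := ltrP 2 t.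
    by rewrite /P /= !ifF //; apply/negbTE; rewrite -ltNge; lra.
  have -> : t = 2 by lra.
  rewrite Pe; last by lra.
  rewrite to_itv_high ?edge_one /v; last by lra.
  by rewrite clamp_high ?C1 //; lra.
have := @loop_family_onto _ _ _ (vertex b0) (fun p => P (p.1, 3 * clamp p.2)).
case=> [|b|b|eta ceta eta_P].
- by apply: (@path_family_of_clamp _ _ _ (fun p => P (p.1, 3 * p.2))); cts.
- by rewrite /= clamp0 mulr0 Pu // /u clamp0 C0.
- rewrite /= clamp1 Pv; last by lra.
  by rewrite mulr1 subrr /v clamp0 C0.
exists eta; split=> //.
(* At stage r the path covers [r, 3 - r]: all of [P] for r = 0, the edge alone for r = 1, with its
   ends moving along the two tracks in between. *)
exists (fun p => P (p.1.1, of_itv p.1.2 + (3 - 2 * of_itv p.1.2) * of_itv p.2)).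
exists (fun p => C (face B ord_max p.1, of_itv p.2)).
exists (fun p => C (face B ord0 p.1, of_itv p.2)).
split; first by split; cts.
move=> b; rewrite /= !of_itv0 !of_itv1 !C0 !C1; split=> // [s|s|r].
- rewrite mulr0 subr0 add0r -[in RHS](of_itvK s).
  have := congr1 (fun h => h (b, of_itv s)) eta_P; rewrite /loop_family /= => ->.
  by rewrite clamp_id // of_itv_itv.
- have := of_itv_itv s => sI; rewrite Pe; last by lra.
  by congr edge; rewrite -[RHS]of_itvK; congr to_itv; ring.
- have rI := of_itv_itv r; rewrite mulr0 addr0 mulr1 Pu; last by lra.
  rewrite Pv; last by lra.
  rewrite /u /v clamp_id //; split=> //.
  have -> : 3 - (of_itv r + (3 - 2 * of_itv r)) = of_itv r by ring.
  by rewrite clamp_id.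
Qed.

Variable eta : B 1%N -> loop_space R (vertex b0).
Hypothesis eta_nat : natural_map eta.

(* Writing [.] for concatenation, the collars u, v of [natural_map] satisfy
   eta.v ~ u.edge, so that eta(d_2 b).eta(d_0 b).v(d_0 b) and
   eta(d_1 b).v(d_1 b) are both homotopic to u(d_2 b).edge(d_2 b).edge(d_0 b):
   the collars at a common vertex agree because B_0 is contractible. *)
Lemma natural_map_mul :
  path_homotopic (path_cat (path_pull (face B (@ord_max 2)) (loop_family eta))
                           (path_pull (face B (@ord0 2)) (loop_family eta)))
                 (path_pull (face B (inord 1 : 'I_3)) (loop_family eta)).
Proof.
have [ceta [K [u [v [[cK cu cv] Kuv]]]]] := eta_nat.
have [? ? ?] := And3 (@clamp_cts R) (@to_itv_cts R) (@vertex_cts R B).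
have to_itv0 : to_itv 0 = zero :> unit_itv R by exact: to_itv_low.
have to_itv1 : to_itv 1 = one :> unit_itv R by exact: to_itv_high.
have to_itvC (t : R) : to_itv (clamp t) = to_itv t.
  by apply: of_itv_inj; rewrite !to_itv_val clampK.
set F := loop_family eta; pose E := @edge_family R B.
pose u0 (p : B 1%N * R) := u (p.1, to_itv p.2).
pose v0 (p : B 1%N * R) := v (p.1, to_itv p.2).
pose U := @vertex R B \o u0; pose V := @vertex R B \o v0.
have pF : path_family F := loop_family_path ceta.
have pE : path_family E := @edge_family_path R B.
have pend (w : B 1%N * unit_itv R -> B 0%N) : continuous w ->
    path_family (fun p => w (p.1, to_itv p.2)).
  move=> cw; split; first by cts.
    by move=> b t t0 /=; rewrite to_itv0 to_itv_low.
  by move=> b t t0 /=; rewrite to_itv1 to_itv_high.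
have [pu0 pv0] := (pend u cu, pend v cv).
have pU : path_family U := path_push_family (@vertex_cts R B) pu0.
have pV : path_family V := path_push_family (@vertex_cts R B) pv0.
have F0 b : F (b, 0) = vertex b0 := loop_family0 eta b.
have F1 b : F (b, 1) = vertex b0 := loop_family1 eta b.
have E0 b : E (b, 0) = vertex (face B ord_max b).
  by rewrite /E /edge_family /= to_itv0 edge_zero.
have E1 b : E (b, 1) = vertex (face B ord0 b).
  by rewrite /E /edge_family /= to_itv1 edge_one.
have u00 b : u0 (b, 0) = b0 by rewrite /u0 /= to_itv0; have [[]] := Kuv b.
have u01 b : u0 (b, 1) = face B ord_max b.
  by rewrite /u0 /= to_itv1; have [[]] := Kuv b.
have v00 b : v0 (b, 0) = b0 by rewrite /v0 /= to_itv0; have [_ []] := Kuv b.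
have v01 b : v0 (b, 1) = face B ord0 b.
  by rewrite /v0 /= to_itv1; have [_ []] := Kuv b.
have U0 b : U (b, 0) = vertex b0 by rewrite /U /= u00.
have U1 b : U (b, 1) = vertex (face B ord_max b) by rewrite /U /= u01.
have V0 b : V (b, 0) = vertex b0 by rewrite /V /= v00.
have V1 b : V (b, 1) = vertex (face B ord0 b) by rewrite /V /= v01.
(* The homotopy [K] of [natural_map] is a square whose sides are the loop, the edge and the two
   collars. *)
have square : path_homotopic (path_cat F V) (path_cat U E).
  have cG : continuous (fun p : B 1%N * (R * R) =>
      K (p.1, to_itv p.2.1, to_itv p.2.2)) by cts.
  have := path_homotopic_square cG.
  set l0 := fun p : B 1%N * R => _; set l1 := fun p : B 1%N * R => _.
  have -> : l0 = F.
    apply/funext => -[b t]; rewrite /l0 /= to_itvC to_itv0.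
    by have [_ _ -> _ _] := Kuv b.
  have -> : l1 = V.
    apply/funext => -[b t]; rewrite /l1 /= to_itvC to_itv1.
    by have [_ _ _ _ /(_ (to_itv t))[_ ->]] := Kuv b.
  set l2 := fun p : B 1%N * R => _; set l3 := fun p : B 1%N * R => _.
  have -> : l2 = U.
    apply/funext => -[b t]; rewrite /l2 /= to_itvC to_itv0.
    by have [_ _ _ _ /(_ (to_itv t))[-> _]] := Kuv b.
  have -> // : l3 = E.
  apply/funext => -[b t]; rewrite /l3 /= to_itvC to_itv1.
  by have [_ _ _ -> _] := Kuv b.
pose d2 : B 2%N -> B 1%N := face B ord_max.
pose d1 : B 2%N -> B 1%N := face B (inord 1).
pose d0 : B 2%N -> B 1%N := face B ord0.
have [cd2 cd1 cd0] : [/\ continuous d2, continuous d1 & continuous d0].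
  by split; exact: cts_fun.
have p2 a := @path_pull_family _ _ _ (realization B) d2 a cd2.
have p1 a := @path_pull_family _ _ _ (realization B) d1 a cd1.
have p0 a := @path_pull_family _ _ _ (realization B) d0 a cd0.
have v2u0 : path_homotopic (path_pull d2 V) (path_pull d0 U).
  apply: (path_homotopic_push (@vertex_cts R B)
    (a := path_pull d2 v0) (b := path_pull d0 u0)).
  apply: path_homotopic_contractible => //; [exact: path_pull_family..| |].
    by move=> b; rewrite /path_pull /= u00 v00.
  by move=> b; rewrite /path_pull /= u01 v01; exact: triangle_vertex1.
have u2u1 : path_homotopic (path_pull d2 U) (path_pull d1 U).
  apply: (path_homotopic_push (@vertex_cts R B)
    (a := path_pull d2 u0) (b := path_pull d1 u0)).
  apply: path_homotopic_contractible => //; [exact: path_pull_family..| |].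
    by move=> b; rewrite /path_pull /= !u00.
  by move=> b; rewrite /path_pull /= !u01; exact: triangle_vertex0.
have v1v0 : path_homotopic (path_pull d1 V) (path_pull d0 V).
  apply: (path_homotopic_push (@vertex_cts R B)
    (a := path_pull d1 v0) (b := path_pull d0 v0)).
  apply: path_homotopic_contractible => //; [exact: path_pull_family..| |].
    by move=> b; rewrite /path_pull /= !v00.
  by move=> b; rewrite /path_pull /= !v01; symmetry; exact: triangle_vertex2.
have e20 : path_homotopic (path_cat (path_pull d2 E) (path_pull d0 E))
    (path_pull d1 E) := edge_family_mul B.
have FV (d : B 2%N -> B 1%N) : continuous d -> path_homotopic
    (path_cat (path_pull d F) (path_pull d V))
    (path_cat (path_pull d U) (path_pull d E)).
  by move=> cd; exact: path_homotopic_pull cd square.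
(* Indexing by faces and up to association, the chain is F2 F0 V0, F2 U0 E0, F2 V2 E0, U2 E2 E0, U1
   E1, F1 V1, F1 V0. *)
apply: (@path_cat_cancelr _ _ _ _ _ (path_pull d0 V)).
- apply: path_cat_family; [exact: p2|exact: p0|].
  by move=> b; rewrite /path_pull /= F1 F0.
- exact: p1.
- by move=> b; rewrite path_cat1 /path_pull /= F1 V0.
- by move=> b; rewrite /path_pull /= F1 V0.
- exact: p0.
apply: path_homotopic_trans.
  apply: path_cat_assoc; [exact: p2|exact: p0|exact: p0| |].
    by move=> b; rewrite /path_pull /= F1 F0.
  by move=> b; rewrite /path_pull /= F1 V0.
apply: path_homotopic_trans.
  apply: path_homotopic_cat (FV d0 cd0) _.
    by apply: path_homotopic_refl; exact: p2.
  by move=> b; rewrite path_cat0 /path_pull /= F1 F0.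
apply: path_homotopic_trans.
  apply: path_homotopic_sym; apply: path_cat_assoc; [exact: p2|exact: p0|exact: p0| |].
    by move=> b; rewrite /path_pull /= F1 U0.
  by move=> b; rewrite /path_pull /= U1 E0.
apply: path_homotopic_trans.
  apply: path_homotopic_cat; last first.
  - by move=> b; rewrite path_cat1 /path_pull /= U1 E0.
  - by apply: path_homotopic_refl; exact: p0.
  apply: path_homotopic_trans (FV d2 cd2).
  apply: path_homotopic_cat (path_homotopic_sym v2u0) _.
    by apply: path_homotopic_refl; exact: p2.
  by move=> b; rewrite /path_pull /= F1 U0.
apply: path_homotopic_trans.
  apply: path_cat_assoc; [exact: p2|exact: p2|exact: p0| |].
    by move=> b; rewrite /path_pull /= U1 E0.
  by move=> b; rewrite /path_pull /= E1 E0 triangle_vertex1.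
apply: path_homotopic_trans.
  apply: path_homotopic_cat u2u1 e20 _.
  by move=> b; rewrite path_cat0 /path_pull /= U1 E0.
apply: path_homotopic_trans (path_homotopic_sym (FV d1 cd1)) _.
apply: path_homotopic_cat v1v0 _; first by apply: path_homotopic_refl; exact: p1.
by move=> b; rewrite /path_pull /= F1 V0.
Qed.

End natural_maps.

(** * Finite powers as function spaces *)

Section function_powers.

Lemma ptws_cts (X Y : topologicalType) n (f : X -> {ptws 'I_n -> Y}) :
  (forall i, continuous (fun x => f x i)) -> continuous f.
Proof.
move=> cf x; apply/cvg_sup => i.
exact: (@continuous_comp_initial _ _ Y (fun g : 'I_n -> Y => g i) f (cf i) x).
Qed.

Lemma eval_cts (Y : topologicalType) n (i : 'I_n) :
  continuous (fun g : {ptws 'I_n -> Y} => g i).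
Proof. exact: (@proj_continuous _ (fun=> Y)). Qed.

End function_powers.

(** * Left inverses in B_1 by way of the loop space *)

Section left_inverses.
Variable R : realType.

(** Inversion of [delooping] at a known structure: [Z], [z] and [k] depend on one another and are
    generalized in [Q], while the match on [sigma] selects the constructor that applies. *)
Lemma delooping_elim (S : topologicalType) (sigma : loop_structure R S)
    (Z : topologicalType) (z : Z) (k : S -> loop_space R z)
    (Q : forall (Z : topologicalType) (z : Z), (S -> loop_space R z) -> Prop) :
  delooping sigma k ->
  match sigma with
  | LoopOf Y y e => Q Y y e
  | LoopSegal B h => forall (h' : S -> B 1%N) (b0 : B 0%N) eta,
      homotopy_inverse R h h' -> @natural_map R B b0 eta ->
      Q (realization B) (vertex b0) (eta \o h')
  end -> Q Z z k.
Proof. by case=> [//|B h h' b0 eta hh' eta_nat]; exact. Qed.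

Variables (B : simplicial_space R) (Y : cw_space R) (y : Y).
Variable f : B 1%N -> loop_space R y.
Hypothesis B_segal : reduced_segal B.
Hypothesis f_loop :
  loop_equivalence (segal_loop_structure B) (loop_space_structure y) f.

(** Since [f] is a loop equivalence, it is homotopic to [loop_map gz] after a natural map [eta], up
    to a homotopy inverse [h'] of the identity, which is itself homotopic to the identity.
    Composition with [g] respects concatenation, so [f] inherits multiplicativity from [eta]. *)
Lemma loop_equivalence_mul :
  path_homotopic (path_cat (path_pull (face B (@ord_max 2)) (loop_family f))
                           (path_pull (face B (@ord0 2)) (loop_family f)))
                 (path_pull (face B (inord 1 : 'I_3)) (loop_family f)).
Proof.
have [_ [Z [Z' [z [z' [k [k' [g [gz [dk dk' kf]]]]]]]]]] := f_loop.
(* The types of [g], [gz] and of the homotopy mention the spaces and base points being inverted, so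
   these are generalized in [Q]. *)
apply: (delooping_elim (Q := fun Z' z' k' => forall (g : continuousType Z Z')
  (gz : g z = z'), homotopic R (k' \o f) (loop_map gz \o k) -> _) dk' _ g gz kf).
apply: (delooping_elim (Q := fun Z z k => forall (g : continuousType Z Y)
  (gz : g z = y), homotopic R f (loop_map gz \o k) -> _) dk).
move=> h' b0 eta [ch' h'id _] eta_nat {dk' k' z' kf gz g dk}.
move=> g gz fg; have cg : continuous g by exact: cts_fun.
have [ceta _] := eta_nat; have peta := loop_family_path ceta.
have [||phi cphi phiE] := @loop_family_onto _ _ _ y _ (path_push_family cg peta).
- by move=> b; rewrite /= loop_family0 gz.
- by move=> b; rewrite /= loop_family1 gz.
have phi_loop : loop_map gz \o eta = phi.
  apply/funext => b; apply: (@loop_family_inj _ _ _ _ _ (loop_map gz \o eta)) => t.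
  by rewrite phiE.
have /loop_family_homotopic fphi : homotopic R f phi.
  apply: homotopic_trans fg _.
  rewrite (_ : _ \o _ = phi \o h'); last by rewrite -phi_loop.
  exact: (homotopic_compl cphi h'id).
have [cd2 cd1 cd0] : [/\ continuous (face B (@ord_max 2)),
    continuous (face B (inord 1 : 'I_3)) & continuous (face B (@ord0 2))].
  by split; exact: cts_fun.
have pull d (cd : continuous d) := @path_homotopic_pull R _ (B 2%N) _ d _ _ cd fphi.
apply: path_homotopic_trans (path_homotopic_cat (pull _ cd2) (pull _ cd0) _) _.
  by move=> b; rewrite /path_pull loop_family0 loop_family1.
apply: path_homotopic_trans (path_homotopic_sym (pull _ cd1)).
have := path_homotopic_push cg (natural_map_mul (segal_contractible B_segal) eta_nat).
by rewrite path_push_cat phiE.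
Qed.

(** This solves x c = e continuously in c, for any [e], the solution x being the edge d_2 of the
    triangle. For a degenerate [e] it is a left inverse. *)
Lemma segal_left_inverse (e : B 1%N) : exists s : B 1%N -> B 2%N,
  [/\ continuous s, homotopic R (face B ord0 \o s) idfun &
      homotopic R (face B (inord 1) \o s) (cst e)].
Proof.
have [[cf [f' [cf' f'f ff']]] _] := f_loop.
have [_ [s2 [cs2 _ s2K]]] := segal_equivalence B_segal (isT : (1 <= 2)%N).
have pf : path_family (loop_family f) := loop_family_path cf.
pose ue : B 1%N -> B 1%N := cst e.
have ce : continuous ue by exact: cst_continuous.
have pe : path_family (path_pull ue (loop_family f)).
  exact: (path_pull_family ce pf).
have pr := path_rev_family pf.
have er w : path_pull ue (loop_family f) (w, 1) = path_rev (loop_family f) (w, 0).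
  by rewrite path_rev0 /path_pull !loop_family1.
(* [rho c] is f(e) followed by the reverse of f(c). Keeping f(e) as a factor avoids comparing it
   with the constant loop. *)
have [||rho crho rhoE] := @loop_family_onto _ _ _ y _ (path_cat_family pe pr er).
- by move=> b; rewrite path_cat0 /path_pull loop_family0.
- by move=> b; rewrite path_cat1 path_rev1 loop_family0.
pose iota := f' \o rho.
(* The prescribed spine of the triangle; [s2], a homotopy inverse of the Segal map, fills it in up
   to homotopy. *)
pose pair (c : B 1%N) : {ptws 'I_2 -> B 1%N} :=
  fun k => if k == ord0 then iota c else c.
have cpair : continuous pair.
  apply: ptws_cts => i; rewrite /pair; case: (i == ord0); last exact: id_cts.
  exact: (app_cts cf' crho).
have pairK (k : 'I_2) : homotopic R (fun c => act B (spine k) (s2 (pair c)))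
                              (fun c => pair c k).
  exact: (homotopic_compl (@eval_cts (B 1%N) 2 k) (homotopic_compr cpair s2K)).
have spine0 b : act B (spine (ord0 : 'I_2)) b = face B (ord_max : 'I_3) b.
  by apply: act_eq => -[[|[|//]] j2]; apply: val_inj; rewrite /= inordK.
have spine1 b : act B (spine (ord_max : 'I_2)) b = face B (ord0 : 'I_3) b.
  by apply: act_eq => -[[|[|//]] j2]; apply: val_inj; rewrite /= inordK.
exists (s2 \o pair); have cs : continuous (s2 \o pair) by exact: app_cts.
have s0 : homotopic R (face B ord0 \o (s2 \o pair)) idfun.
  have := pairK ord_max; rewrite /pair /= => h.
  by rewrite [X in homotopic _ X](_ : _ = fun c => act B (spine ord_max) (s2 (pair c)));
    last by apply/funext => c; rewrite spine1.
have s2h : homotopic R (face B ord_max \o (s2 \o pair)) iota.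
  have := pairK ord0; rewrite /pair /= => h.
  by rewrite [X in homotopic _ X](_ : _ = fun c => act B (spine ord0) (s2 (pair c)));
    last by apply/funext => c; rewrite spine0.
split=> //.
have fs2 : homotopic R (f \o (face B ord_max \o (s2 \o pair))) rho.
  apply: homotopic_trans (homotopic_compl cf s2h) _.
  exact: (homotopic_compr crho ff').
have fs0 : homotopic R (f \o (face B ord0 \o (s2 \o pair))) f.
  exact: (homotopic_compl cf s0).
(* With s for [s2 \o pair], f(d_1 s) is homotopic to f(d_2 s) f(d_0 s), hence to f(e) times the
   reverse of f(c) times f(c), hence to f(e). *)
have fs1 : homotopic R (f \o (face B (inord 1) \o (s2 \o pair))) (f \o ue).
  apply: homotopic_loop_family.
  apply: path_homotopic_trans (path_homotopic_sym
    (path_homotopic_pull cs loop_equivalence_mul)) _.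
  apply: path_homotopic_trans.
    apply: (path_homotopic_cat (loop_family_homotopic fs2) (loop_family_homotopic fs0)).
    by move=> b; rewrite loop_family0 loop_family1.
  rewrite rhoE; apply: path_homotopic_trans.
    apply: path_cat_assoc => // b.
    by rewrite path_rev1.
  apply: path_homotopic_trans (path_cat_constr pe).
  apply: path_homotopic_cat.
  - exact: path_homotopic_refl.
  - have := path_cat_revl pf; congr path_homotopic; apply/funext => p.
    by rewrite /path_pull !loop_family1.
  - by move=> b; rewrite path_cat0 er.
have back (phi : B 1%N -> B 1%N) : continuous phi ->
    homotopic R (f' \o (f \o phi)) phi.
  by move=> cphi; exact: (homotopic_compr cphi f'f).
have cs1 : continuous (face B (inord 1) \o (s2 \o pair)).
  by apply: app_cts => //; exact: cts_fun.
apply: homotopic_trans (homotopic_sym (back _ cs1)) _.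
apply: homotopic_trans (homotopic_compl cf' fs1) _.
exact: back.
Qed.

End left_inverses.

(** * Path components *)

Section path_components.
Variable R : realType.
Implicit Types X Y : topologicalType.

Lemma pi0_classP X (x x' : X) :
  pi0_class R x = pi0_class R x' <->
  clos_refl_sym_trans X (@path_related R X) x x'.
Proof.
split=> [/eqmodP/asboolP //|xx'].
by apply/eqmodP/asboolP.
Qed.

Lemma pi0_class_map X Y (g : X -> Y) (x x' : X) : continuous g ->
  pi0_class R x = pi0_class R x' -> pi0_class R (g x) = pi0_class R (g x').
Proof.
move=> cg /pi0_classP; elim=> {x x'} [x x' [p]|//|x x' _ ->//|x y z _ -> _ ->//].
apply/pi0_classP; apply: rst_step; split.
have cgp : continuous (g \o (p : unit_itv R -> X)).
  by apply: app_cts => //; exact: cts_fun.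
have gp0 : (g \o (p : unit_itv R -> X)) zero = g x by rewrite /= path_zero.
have gp1 : (g \o (p : unit_itv R -> X)) one = g x' by rewrite /= path_one.
exact: (mk_path cgp gp0 gp1 : {path unit_itv R from g x to g x'}).
Qed.

Lemma pi0_class_homotopic X Y (f g : X -> Y) (x : X) :
  homotopic R f g -> pi0_class R (f x) = pi0_class R (g x).
Proof.
move=> [H cH Hfg]; have [H0 H1] := Hfg x; apply/pi0_classP; apply: rst_step; split.
have cHx : continuous (fun s : unit_itv R => H (x, s)) by cts.
exact: (mk_path cHx H0 H1 : {path unit_itv R from f x to g x}).
Qed.

Lemma pi0_class_contractible X (x x' : X) :
  contractible R X -> pi0_class R x = pi0_class R x'.
Proof. by move=> /(contractible_to x) /(pi0_class_homotopic x'). Qed.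

Lemma pi0_class_repr X (p : pi0 R X) : pi0_class R (repr p) = p.
Proof. exact: reprK. Qed.

(* The coordinates are changed one at a time. *)
Lemma pi0_class_ptws X n (f g : {ptws 'I_n -> X}) :
  (forall i, pi0_class R (f i) = pi0_class R (g i)) ->
  pi0_class R f = pi0_class R g.
Proof.
move=> fg; pose h m : {ptws 'I_n -> X} := fun i => if (i < m)%N then g i else f i.
have -> : f = h 0%N by apply/funext => i.
have -> : g = h n by apply/funext => i; rewrite /h ltn_ord.
suff hm m : (m <= n)%N -> pi0_class R (h 0%N) = pi0_class R (h m) by exact: hm.
elim: m => // m IHm mn; rewrite IHm; last exact: ltnW.
pose im := Ordinal mn.
pose k (x : X) : {ptws 'I_n -> X} := fun i => if i == im then x else h m i.
have ck : continuous k.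
  apply: ptws_cts => i; rewrite /k; case: (i == im); first exact: id_cts.
  exact: cst_continuous.
have -> : h m = k (f im).
  apply/funext => i; rewrite /k; case: eqP => // ->.
  by rewrite /h /= ltnn.
have -> : h m.+1 = k (g im).
  apply/funext => i; rewrite /k -val_eqE /h /=; case: eqP => [iE|/eqP im'].
    by rewrite iE ltnSn; congr g; exact: val_inj.
  by rewrite ltnS leq_eqVlt (negbTE im').
exact: pi0_class_map.
Qed.

End path_components.

(** * The group of components of a Segal space *)

Definition degenerate01 : 'I_2 -> 'I_1 := fun=> ord0.

Lemma degenerate01_le : {homo degenerate01 : i j / (i <= j)%O}.
Proof. by []. Qed.

HB.instance Definition _ :=
  Order.isOrderMorphism.Build _ 'I_2 _ 'I_1 degenerate01 degenerate01_le.

(** The codegeneracy repeating 0, as the predecessor of 0 is 0. The triangle it induces on x has a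
    degenerate first edge and x as its other two edges, which gives the left unit law. *)
Definition degenerate12 (j : 'I_3) : 'I_2 := inord j.-1.

Lemma degenerate12_le : {homo degenerate12 : i j / (i <= j)%O}.
Proof.
move=> i j; rewrite !leEord /degenerate12 => ij.
by rewrite !inordK; [case: i j ij => -[|i] ? [[|j] ?] |case: j {ij} => -[]|case: i {ij} => -[]].
Qed.

HB.instance Definition _ :=
  Order.isOrderMorphism.Build _ 'I_3 _ 'I_2 degenerate12 degenerate12_le.

Section segal_groups.
Variables (R : realType) (C : simplicial_space R).
Hypothesis C0 : contractible R (C 0%N).
Hypothesis C_segal : forall n, (1 <= n)%N -> homotopy_equivalence R (@segal_map R C n).

Local Notation cl := (pi0_class R).

(** Together with [segal_pi0_inj] it identifies the components of [C n] with n-tuples of components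
    of [C 1]. *)
Lemma segal_pi0_onto n (x : 'I_n -> pi0 R (C 1%N)) : (1 <= n)%N ->
  exists b : C n, forall k, cl (act C (spine k) b) = x k.
Proof.
move=> /C_segal[_ [s [_ _ sK]]].
pose r : {ptws 'I_n -> C 1%N} := fun k => repr (x k).
exists (s r) => k; rewrite -[RHS]pi0_class_repr.
exact: (pi0_class_map (@eval_cts _ n k) (pi0_class_homotopic r sK)).
Qed.

Lemma segal_pi0_inj n (b b' : C n) : (1 <= n)%N ->
  (forall k : 'I_n, cl (act C (spine k) b) = cl (act C (spine k) b')) ->
  cl b = cl b'.
Proof.
move=> /C_segal[_ [s [cs sK _]]] bb'.
rewrite -(pi0_class_homotopic b sK) -(pi0_class_homotopic b' sK).
exact: (pi0_class_map cs (pi0_class_ptws bb')).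
Qed.

(** Left inverses are the part of the group structure that the Segal condition does not supply. *)
Hypothesis C_inverse : forall x : C 1%N, exists2 b : C 2%N,
  cl (face C ord0 b) = cl x &
  exists c : C 0%N, cl (face C (inord 1) b) = cl (act C degenerate01 c).

Lemma segal_pi0_group : pi0_is_group C.
Proof.
(* The product is d_1 of any triangle with spine [p], [q]; [segal_pi0_inj] makes it independent of
   the triangle. *)
have mulP (p q : pi0 R (C 1%N)) : exists r, forall b : C 2%N,
    cl (segal_map b ord0) = p -> cl (segal_map b ord_max) = q ->
    r = cl (face C (inord 1) b).
  have [b bE] := segal_pi0_onto (fun k : 'I_2 => if k == ord0 then p else q) isT.
  exists (cl (face C (inord 1) b)) => b' b'0 b'1.
  apply: pi0_class_map; first exact: cts_fun.
  apply: segal_pi0_inj => // k; rewrite bE; case: eqP => [->|k0].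
    by rewrite -b'0.
  rewrite -b'1 /segal_map; congr (cl (act C (spine _) b')).
  by case: k k0 => -[|[|//]] k2 k0; [case: k0|]; exact: val_inj.
pose mul p q := projT1 (cid (mulP p q)).
have mulE (b : C 2%N) p q : cl (segal_map b ord0) = p ->
    cl (segal_map b ord_max) = q -> mul p q = cl (face C (inord 1) b).
  by move=> b0 b1; rewrite /mul; case: cid => r /= /(_ b b0 b1).
have spine0 (b : C 2%N) : segal_map b ord0 = face C ord_max b.
  by apply: act_eq => -[[|[|//]] j2]; apply: val_inj; rewrite /= inordK.
have spine1 (b : C 2%N) : segal_map b ord_max = face C ord0 b.
  by apply: act_eq => -[[|[|//]] j2]; apply: val_inj; rewrite /= inordK.
have [c0 _] := C0.
pose e := cl (act C degenerate01 c0).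
have eE c : cl (act C degenerate01 c) = e.
  apply: pi0_class_map; first exact: cts_fun.
  exact: pi0_class_contractible.
have invP (p : pi0 R (C 1%N)) : exists q, mul q p = e.
  have [b b0 [c b1]] := C_inverse (repr p).
  exists (cl (segal_map b ord0)); rewrite (mulE b) ?b1 //.
  by rewrite spine1 b0 pi0_class_repr.
exists mul, e, (fun p => projT1 (cid (invP p))); split.
- move=> p q r.
  (* A 3-simplex with spine [p], [q], [r]. The faces [F] 3 and [F] 0 compute pq and qr; the faces
     [F] 1 and [F] 2 then compute the two triple products, both equal to the class of the edge from
     vertex 0 to vertex 3. *)
  have [b bE] := segal_pi0_onto (fun k : 'I_3 =>
    if val k == 0%N then p else if val k == 1%N then q else r) isT.
  have bp : cl (act C (spine (ord0 : 'I_3)) b) = p := bE ord0.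
  have bq : cl (act C (spine (Ordinal (isT : (1 < 3)%N))) b) = q := bE _.
  have br : cl (act C (spine (ord_max : 'I_3)) b) = r := bE ord_max.
  pose F (i : 'I_4) := act C (coface i) b.
  have F3 : mul p q = cl (act C (coface (inord 1 : 'I_3)) (F ord_max)).
    apply: mulE.
      rewrite -bp; congr cl; rewrite /segal_map /F.
      by apply: act_act => -[[|[|//]] j2]; apply: val_inj; rewrite /= !inordK.
    rewrite -bq; congr cl; rewrite /segal_map /F.
    by apply: act_act => -[[|[|//]] j2]; apply: val_inj; rewrite /= !inordK.
  have F0 : mul q r = cl (act C (coface (inord 1 : 'I_3)) (F ord0)).
    apply: mulE.
      rewrite -bq; congr cl; rewrite /segal_map /F.
      by apply: act_act => -[[|[|//]] j2]; apply: val_inj; rewrite /= !inordK.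
    rewrite -br; congr cl; rewrite /segal_map /F.
    by apply: act_act => -[[|[|//]] j2]; apply: val_inj; rewrite /= !inordK.
  have F2 : mul p (mul q r) = cl (act C (coface (inord 1 : 'I_3))
      (F (Ordinal (isT : (2 < 4)%N)))).
    rewrite F0; apply: mulE.
      rewrite -bp; congr cl; rewrite /segal_map /F.
      by apply: act_act => -[[|[|//]] j2]; apply: val_inj; rewrite /= !inordK.
    congr cl; rewrite /segal_map /F -[RHS](act_comp (coface _) (coface _)).
    by apply: act_act => -[[|[|//]] j2]; apply: val_inj; rewrite /= !inordK.
  have F1 : mul (mul p q) r = cl (act C (coface (inord 1 : 'I_3))
      (F (Ordinal (isT : (1 < 4)%N)))).
    rewrite F3; apply: mulE.
      congr cl; rewrite /segal_map /F -[RHS](act_comp (coface _) (coface _)).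
      by apply: act_act => -[[|[|//]] j2]; apply: val_inj; rewrite /= !inordK.
    rewrite -br; congr cl; rewrite /segal_map /F.
    by apply: act_act => -[[|[|//]] j2]; apply: val_inj; rewrite /= !inordK.
  rewrite F2 F1; congr cl; rewrite /F -[RHS](act_comp (coface _) (coface _)).
  by apply: act_act => -[[|[|//]] j2]; apply: val_inj; rewrite /= !inordK.
- move=> p; rewrite -[p]pi0_class_repr; move: (repr p) => {}x.
  have -> : mul e (cl x) = cl (face C (inord 1) (act C degenerate12 x)).
    apply: mulE.
      rewrite -(eE (face C ord_max x)); congr cl.
      rewrite /segal_map -[RHS](act_comp degenerate01 (coface _)).
      by apply: act_act => -[[|[|//]] j2]; apply: val_inj; rewrite /= !inordK.
    congr cl; rewrite -[RHS](act_id x) /segal_map.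
    by apply: act_act => -[[|[|//]] j2]; apply: val_inj; rewrite /= !inordK.
  congr cl; rewrite -[RHS](act_id x) /face.
  by apply: act_act => -[[|[|//]] j2]; apply: val_inj; rewrite /= /degenerate12 /= inord1_val inordK.
- by move=> p; case: cid.
- by move=> b; exact: mulE.
Qed.

End segal_groups.

(** * HM functors on homotopies, finite powers and Segal maps *)

Section hm_functors.
Variables (R : realType) (L : top_functor R).
Hypothesis hL : hm_functor L.
Implicit Types X Y Z : cw_space R.

Lemma top_map_eq X Y (f g : continuousType X Y) z :
  f =1 g -> top_map L f z = top_map L g z.
Proof. by move=> /continuousEP ->. Qed.

Lemma top_map_map X Y Z (f : continuousType X Y) (g : continuousType Y Z)
    (h : continuousType X Z) z : g \o f =1 h ->
  top_map L g (top_map L f z) = top_map L h z.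
Proof. by move=> gf; rewrite -[LHS](top_map_comp f g z) (top_map_eq z gf). Qed.

Lemma top_map_mkcts X Y (f : X -> Y) (cf : continuous f) :
  homotopy_equivalence R f ->
  homotopy_equivalence R (top_map L (mkcts cf : continuousType X Y)).
Proof. exact: (@hm_equivalence _ _ hL X Y (mkcts cf)). Qed.

(* The two ends of the cylinder have the common homotopy inverse [X * I -> X]. *)
Lemma top_map_homotopic X Y (f g : continuousType X Y) :
  homotopic R f g -> homotopic R (top_map L f) (top_map L g).
Proof.
move=> [H cH Hfg].
have cin (s : unit_itv R) : continuous (fun x : X => (x, s)) by cts.
have fstE : homotopy_equivalence R (@fst X (unit_itv R)).
  split; first exact: fst_continuous.
  exists (fun x => (x, zero)); split=> //.
    apply/homotopicP; exists (fun p => (p.1.1, to_itv (p.2 * of_itv p.1.2))).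
      have [? ?] := (@to_itv_cts R, @of_itv_cts R).
      by cts.
    move=> [x s] /=; rewrite mul0r mul1r of_itvK to_itv_low //.
  by apply: homotopic_refl; exact: id_cts.
pose XI := CWSpace (cw_type_equivalent fstE (cw_space_type X)).
pose pr : continuousType XI X := fst_map X (unit_itv R).
pose i (s : unit_itv R) : continuousType X XI := mkcts (cin s).
pose h : continuousType XI Y := mkcts cH.
have [cpr [r [cr rpr prr]]] := hm_equivalence hL (f := pr) fstE.
have ir s : homotopic R (top_map L (i s)) r.
  apply: homotopic_trans (homotopic_sym (homotopic_compr
    (@cts_fun _ _ (top_map L (i s))) rpr)) _.
  rewrite (_ : _ \o _ = r); first exact: homotopic_refl.
  apply/funext => z /=; congr r; rewrite -[RHS](@top_map_id _ L X).
  exact: top_map_map.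
have hi s (k : continuousType X Y) : (forall x, H (x, s) = k x) ->
    top_map L k = top_map L h \o top_map L (i s) :> (L X -> L Y).
  move=> Hk; apply/funext => z /=; symmetry; apply: top_map_map => x.
  exact: Hk.
rewrite (hi zero f) ?(hi one g); [|by move=> x; case: (Hfg x)..].
apply: homotopic_compl; first exact: cts_fun.
exact: homotopic_trans (ir _) (homotopic_sym (ir _)).
Qed.

Definition eval_map X n (i : 'I_n) : continuousType {ptws 'I_n -> X} X :=
  mkcts (@eval_cts X n i).

Lemma contractible_ptws0 (X : topologicalType) : contractible R {ptws 'I_0 -> X}.
Proof.
have f0 (f g : {ptws 'I_0 -> X}) : f = g by apply/funext => -[].
exists (fun i : 'I_0 => False_rect X (notF (valP i))).
apply/homotopicP; exists (fun p => p.1); first by cts.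
by move=> x; split; exact: f0.
Qed.

(** Induction on [n], splitting off the first coordinate: the empty power is contractible, and the
    step is the product condition on L. All powers are required to have CW type because the
    induction passes through them. *)
Lemma top_map_power X (P : forall n, cw_type R {ptws 'I_n -> X}) n :
  homotopy_equivalence R (fun (z : L (CWSpace (P n))) =>
    (fun i => top_map L (eval_map X i : continuousType (CWSpace (P n)) X) z)
    : {ptws 'I_n -> L X}).
Proof.
elim: n => [|n IHn].
  apply: contractible_equivalence.
  - by apply: ptws_cts => -[].
  - by apply: (hm_contractible hL); exact: contractible_ptws0.
  - exact: contractible_ptws0.
have split_cts (T : topologicalType) : continuous (fun f : {ptws 'I_n.+1 -> T} =>
    (f ord0, (fun i => f (lift ord0 i)) : {ptws 'I_n -> T})).
  apply: pair_cts; first exact: eval_cts.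
  by apply: ptws_cts => i; exact: eval_cts.
pose cons T (p : T * {ptws 'I_n -> T}) : {ptws 'I_n.+1 -> T} :=
  fun i => if unlift ord0 i is Some j then p.2 j else p.1.
have cons_cts (T : topologicalType) : continuous (@cons T).
  apply: ptws_cts => i; rewrite /cons; case: (unlift ord0 i) => [j|]; last exact: fst_continuous.
  by apply: (app_cts (@eval_cts T n j)); exact: snd_continuous.
have splitK (T : topologicalType) : cancel (fun f : {ptws 'I_n.+1 -> T} =>
    (f ord0, (fun i => f (lift ord0 i)) : {ptws 'I_n -> T})) (@cons T).
  by move=> f; apply/funext => i; rewrite /cons; case: unliftP => [j|] ->.
have consK (T : topologicalType) : cancel (@cons T) (fun f : {ptws 'I_n.+1 -> T} =>
    (f ord0, (fun i => f (lift ord0 i)) : {ptws 'I_n -> T})).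
  move=> [x f]; rewrite /cons unlift_none /=; congr pair.
  by apply/funext => i; rewrite liftK.
have splitE := homeomorphism_equivalence R (@split_cts X) (@cons_cts X)
  (@splitK X) (@consK X).
have consE := homeomorphism_equivalence R (@cons_cts (L X)) (@split_cts (L X))
  (@consK (L X)) (@splitK (L X)).
have XP : cw_type R (X * CWSpace (P n))%type := cw_type_equivalent_inv splitE (P n.+1).
have := homotopy_equivalence_comp (homotopy_equivalence_comp
  (homotopy_equivalence_comp
    (@top_map_mkcts (CWSpace (P n.+1)) (CWSpace XP) _ (@split_cts X) splitE)
    (hm_product hL XP))
  (@homotopy_equivalence_prodr _ _ _ (L X) _ IHn)) consE.
congr (homotopy_equivalence R _); apply/funext => z; apply/funext => i.
rewrite /cons /=; case: unliftP => [j|] -> /=.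
  pose tail : continuousType (CWSpace (P n.+1)) (CWSpace (P n)) :=
    mkcts (app_cts (@snd_continuous _ _) (@split_cts X)).
  rewrite (top_map_map (h := tail)) //.
  exact: top_map_map.
exact: top_map_map.
Qed.

(** The Segal map of L B is L of the Segal map of B followed by the comparison of powers. *)
Lemma apply_segal_equivalence (B : simplicial_space R) : reduced_segal B ->
  forall n, (1 <= n)%N ->
  homotopy_equivalence R (@segal_map R (apply_simplicial L B) n).
Proof.
move=> [B0 Bn _] n n1.
have P m : cw_type R {ptws 'I_m -> B 1%N}.
  (* The Segal condition starts at 1; for m = 0 both [B 0] and the empty power are contractible. *)
  case: m => [|m]; last exact: cw_type_equivalent_inv (Bn m.+1 isT) (cw_space_type _).
  have c0 : continuous (@segal_map R B 0) by apply: ptws_cts => -[].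
  apply: cw_type_equivalent_inv (cw_space_type (B 0%N)).
  by apply: (contractible_equivalence c0) => //; exact: contractible_ptws0.
have [cs _] := Bn n n1.
have := homotopy_equivalence_comp
  (@top_map_mkcts (B n) (CWSpace (P n)) _ cs (Bn n n1)) (top_map_power P n).
congr (homotopy_equivalence R _); apply/funext => z; apply/funext => i /=.
exact: top_map_map.
Qed.

End hm_functors.

(** * Applying the functor to a homotopy action *)

Section homotopy_actions.
Variables (R : realType) (L : top_functor R).
Hypothesis hL : hm_functor L.

Lemma top_map_pair (X Y Z : cw_space R) (f : continuousType X Y)
    (g : continuousType X Z) :
  homotopy_equivalence R (fun x => (f x, g x)) ->
  homotopy_equivalence R (fun z => (top_map L f z, top_map L g z)).
Proof.
move=> fgE; have [cfg _] := fgE.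
have YZ : cw_type R (Y * Z)%type := cw_type_equivalent_inv fgE (cw_space_type X).
have := homotopy_equivalence_comp (@top_map_mkcts _ _ hL X (CWSpace YZ) _ cfg fgE)
  (hm_product hL YZ).
congr (homotopy_equivalence R _); apply/funext => z.
by rewrite /canonical_map /=; congr pair; exact: top_map_map.
Qed.

Lemma front_cts (A : simplicial_space R) n : continuous (@front R A n).
Proof.
elim: n => [|n IHn]; first exact: id_cts.
by apply: (app_cts IHn); exact: cts_fun.
Qed.

Lemma back_cts (A : simplicial_space R) n : continuous (@back R A n).
Proof.
elim: n => [|n IHn]; first exact: id_cts.
by apply: (app_cts IHn); exact: cts_fun.
Qed.

Lemma apply_front (A : simplicial_space R) n (z : L (A n)) :
  @front R (apply_simplicial L A) n z =
  top_map L (mkcts (@front_cts A n) : continuousType (A n) (A 0%N)) z.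
Proof.
elim: n z => [|n IHn] z /=.
  by rewrite -[LHS](@top_map_id _ L (A 0%N)); exact: top_map_eq.
by rewrite IHn; exact: top_map_map.
Qed.

Lemma apply_back (A : simplicial_space R) n (z : L (A n)) :
  @back R (apply_simplicial L A) n z =
  top_map L (mkcts (@back_cts A n) : continuousType (A n) (A 0%N)) z.
Proof.
elim: n z => [|n IHn] z /=.
  by rewrite -[LHS](@top_map_id _ L (A 0%N)); exact: top_map_eq.
by rewrite IHn; exact: top_map_map.
Qed.

Lemma apply_reduced_segal (B : simplicial_space R) (Y : cw_space R) (y : Y)
    (f : B 1%N -> loop_space R y) : reduced_segal B ->
  loop_equivalence (segal_loop_structure B) (loop_space_structure y) f ->
  reduced_segal (apply_simplicial L B).
Proof.
move=> B_segal f_loop; have [B0 _ _] := B_segal.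
have C0 : contractible R (apply_simplicial L B 0%N) := hm_contractible hL B0.
have C_segal := @apply_segal_equivalence _ _ hL _ B_segal.
split=> //; apply: (segal_pi0_group C0 C_segal) => x.
have [b0 _] := B0.
have [s [cs s0 s1]] := segal_left_inverse B_segal f_loop (act B degenerate01 b0).
pose sigma : continuousType (B 1%N) (B 2%N) := mkcts cs.
(* L of a constant map need not be constant. Factoring the constant map through [B 0] followed by a
   degeneracy ensures that its image under L consists of degenerate edges of L B. *)
pose base : continuousType (B 1%N) (B 0%N) := cst b0.
exists (top_map L sigma x).
  have := pi0_class_homotopic x (top_map_homotopic hL
    (f := face B ord0 \o sigma) (g := idfun) s0).
  by rewrite (top_map_comp sigma (face B ord0) x) (@top_map_id _ L (B 1%N) x).
exists (top_map L base x).
have := pi0_class_homotopic x (top_map_homotopic hL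
  (f := face B (inord 1) \o sigma) (g := act B degenerate01 \o base) s1).
by rewrite (top_map_comp sigma (face B (inord 1)) x)
  (top_map_comp base (act B degenerate01) x).
Qed.

(** Both structures deloop to the realization of [C], one by [eta] and the other by [eta \o h'], so
    the identity serves as the map between deloopings; the required homotopy comes from that of
    [h' \o h] to the identity. *)
Lemma loop_equivalence_segal (C : simplicial_space R) (S : topologicalType)
    (h : C 1%N -> S) : contractible R (C 0%N) -> homotopy_equivalence R h ->
  loop_equivalence (segal_loop_structure C) (LoopSegal h) h.
Proof.
move=> C0 /[dup] hE [ch [h' hh']]; split=> //; have [c0 _] := C0.
have [eta eta_nat] := natural_map_exists c0 C0; have [ceta _] := eta_nat.
exists (realization C), (realization C), (vertex c0), (vertex c0).
exists (eta \o idfun), (eta \o h'), idfun, erefl; split.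
- apply: DeloopSegal => //; split; first exact: id_cts.
    by apply: homotopic_refl; exact: id_cts.
  by apply: homotopic_refl; exact: id_cts.
- exact: DeloopSegal.
- have -> : loop_map (erefl (idfun (vertex c0))) \o (eta \o idfun) = eta.
    by apply/funext => b; apply/path_eqP.
  by have [_ h'h _] := hh'; exact: (homotopic_compl ceta h'h).
Qed.

End homotopy_actions.

Theorem proposition5p9 (R : realType) (L : top_functor R) (hL : hm_functor L)
  (X Y : cw_space R) (y : Y) (hOmega : cw_type R (loop_space R y))
  (A B : simplicial_space R) (q : simplicial_map A B)
  (f : continuousType (B 1%N) (CWSpace hOmega))
  (hq : homotopy_action q X (S := CWSpace hOmega) (loop_space_structure y) f) :
  homotopy_action (apply_simplicial_map L q) (L X) (S := L (CWSpace hOmega))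
    (LoopSegal (B := apply_simplicial L B) (top_map L f)) (top_map L f).
Proof.
have [[g gE] [B_segal _ f_loop] q_front q_back] := hq.
have LB_segal := apply_reduced_segal hL B_segal f_loop.
have fE : homotopy_equivalence R (top_map L f) := hm_equivalence hL f_loop.1.
split.
- have [cg _] := gE; exists (top_map L (mkcts cg : continuousType (A 0%N) X)).
  exact: top_map_mkcts.
- split=> //; apply: loop_equivalence_segal => //.
  exact: segal_contractible LB_segal.
- move=> n; under eq_fun do rewrite apply_front.
  exact: (@top_map_pair _ _ hL (A n) (A 0%N) _ (mkcts (@front_cts R A n)) _ (q_front n)).
- move=> n; under eq_fun do rewrite apply_back.
  exact: (@top_map_pair _ _ hL (A n) (A 0%N) _ (mkcts (@back_cts R A n)) _ (q_back n)).
Qed.
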